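(* Let $X$ be a metric space, $r>0$, and let $\mathcal{U}$ be a good numerable cover of $X$ such that for every finite subset $\sigma\subset X$: $\sigma$ is contained in some element of $\mathcal{U}$ iff $\operatorname{Diam}(\sigma)<r$. Then $\operatorname{Rips}(X,r)\simeq X$. Likewise, if $\mathcal{U}$ is a good numerable cover of $X$ such that for every finite $\sigma\subset X$: $\sigma$ is contained in some element of $\mathcal{U}$ iff $\operatorname{Diam}(\sigma)\le r$, then $\overline{\operatorname{Rips}}(X,r)\simeq X$.
   Context: $\operatorname{Rips}(X,r)$ (resp. $\overline{\operatorname{Rips}}(X,r)$) is the simplicial complex with vertex set $X$ whose simplices are finite subsets of diameter $<r$ (resp. $\le r$), with the weak topology. A cover is good if every finite intersection of its members is empty or contractible. A cover $\mathcal{U}$ of $X$ is numerable if there is a locally finite partition of unity on $X$ subordinated to $\mathcal{U}$ (each function has support contained in some member of $\mathcal{U}$). *)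

(* Defs.v *)
From Stdlib Require Import Reals List.
Open Scope R_scope.
Set Implicit Arguments.

Record space := Space { pt : Type; is_open : (pt -> Prop) -> Prop }.

Definition continuous (A B : space) (f : pt A -> pt B) : Prop :=
  forall V, is_open B V -> is_open A (fun a => V (f a)).

Definition subspace (S : space) (P : pt S -> Prop) : space :=
  @Space {x : pt S | P x}
        (fun W => exists V, is_open S V /\ forall x, W x <-> V (proj1_sig x)).

Definition is_metric (X : Type) (d : X -> X -> R) : Prop :=
  (forall x y, 0 <= d x y) /\
  (forall x y, d x y = 0 <-> x = y) /\
  (forall x y, d x y = d y x) /\
  (forall x y z, d x z <= d x y + d y z).

Definition metric_space (X : Type) (d : X -> X -> R) : space :=
  @Space X (fun U => forall x, U x ->
             exists eps, 0 < eps /\ forall y, d x y < eps -> U y).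

Definition R_space : space := metric_space (fun a b : R => Rabs (a - b)).

Definition unit_interval : space := subspace R_space (fun t => 0 <= t <= 1).

Definition prod_I (A : space) : space :=
  @Space (pt A * pt unit_interval)%type
    (fun W => forall a t, W (a, t) ->
       exists U V, is_open A U /\ U a /\ is_open unit_interval V /\ V t /\
         forall a' t', U a' -> V t' -> W (a', t')).

Definition homotopic (A B : space) (f g : pt A -> pt B) : Prop :=
  exists H : pt (prod_I A) -> pt B,
    continuous (prod_I A) B H /\
    (forall a (t : pt unit_interval), proj1_sig t = 0 -> H (a, t) = f a) /\
    (forall a (t : pt unit_interval), proj1_sig t = 1 -> H (a, t) = g a).

Definition homotopy_equivalent (A B : space) : Prop :=
  exists (f : pt A -> pt B) (g : pt B -> pt A),
    continuous A B f /\ continuous B A g /\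
    homotopic A A (fun a => g (f a)) (fun a => a) /\
    homotopic B B (fun b => f (g b)) (fun b => b).

Definition contractible (A : space) : Prop :=
  exists a0 : pt A, homotopic A A (fun a => a) (fun _ => a0).

Definition lsum (T : Type) (f : T -> R) (l : list T) : R :=
  fold_right Rplus 0 (map f l).

Definition diam (X : Type) (d : X -> X -> R) (s : list X) : R :=
  fold_right Rmax 0 (map (fun p => d (fst p) (snd p)) (list_prod s s)).

(** * Geometric realization of a simplicial complex with vertex set X
    whose simplices are the finite sets satisfying K, with the weak topology.
    A point is a function X -> R (barycentric coordinates), nonnegative,
    supported in some simplex, summing to 1. *)
Definition is_rpoint (X : Type) (K : list X -> Prop) (f : X -> R) : Prop :=
  (forall x, 0 <= f x) /\
  exists s, NoDup s /\ K s /\ (forall x, f x <> 0 -> In x s) /\ lsum f s = 1.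

(** Weak topology: W is open iff its trace on every closed simplex |s|
    is open in the Euclidean topology of |s|. *)
Definition realization (X : Type) (K : list X -> Prop) : space :=
  @Space {f : X -> R | is_rpoint K f}
    (fun W => forall s, NoDup s -> K s ->
       forall p : {f : X -> R | is_rpoint K f}, W p ->
         (forall x, proj1_sig p x <> 0 -> In x s) ->
         exists eps, 0 < eps /\
           forall q : {f : X -> R | is_rpoint K f},
             (forall x, proj1_sig q x <> 0 -> In x s) ->
             (forall x, In x s -> Rabs (proj1_sig q x - proj1_sig p x) < eps) ->
             W q).

Definition Rips (X : Type) (d : X -> X -> R) (r : R) : space :=
  realization (fun s => diam d s < r).
Definition Rips_closed (X : Type) (d : X -> X -> R) (r : R) : space :=
  realization (fun s => diam d s <= r).

Definition is_cover (X : Type) (I : Type) (U : I -> X -> Prop) : Prop :=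
  forall x, exists i, U i x.

Definition good_cover (X : Type) (d : X -> X -> R) (I : Type) (U : I -> X -> Prop) : Prop :=
  forall l : list I, l <> nil ->
    let P := fun x => forall i, In i l -> U i x in
    (forall x, ~ P x) \/ contractible (subspace (metric_space d) P).

Definition support (X : Type) (d : X -> X -> R) (phi : X -> R) (y : X) : Prop :=
  forall eps, 0 < eps -> exists x, d x y < eps /\ phi x <> 0.

Definition numerable_cover (X : Type) (d : X -> X -> R) (I : Type) (U : I -> X -> Prop) : Prop :=
  exists (J : Type) (phi : J -> X -> R),
    (forall j, continuous (metric_space d) R_space (phi j)) /\
    (forall j x, 0 <= phi j x) /\
    (forall x, exists V, is_open (metric_space d) V /\ V x /\
       exists l : list J, forall j, (exists y, V y /\ support d (phi j) y) -> In j l) /\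
    (forall x, exists l : list J, NoDup l /\ (forall j, phi j x <> 0 -> In j l) /\
       lsum (fun j => phi j x) l = 1) /\
    (forall j, exists i, forall x, support d (phi j) x -> U i x).

Definition in_some_member (X I : Type) (U : I -> X -> Prop) (s : list X) : Prop :=
  exists i, forall x, In x s -> U i x.

(* Main.v *)
(** The Rips complex is the complex of finite sets having a common member of the cover, so by Dowker duality it is homotopy equivalent to the nerve of the cover, and it remains to compare the nerve with the space.

Both equivalences come from one construction. Let [W a] be subsets of [Y], indexed by the vertices of a complex, whose intersections over simplices are contractible. A point [t] of the realization gives a chain of superlevel sets of its barycentric coordinates; starting at a point of the smallest intersection one contracts successively along the intersections over these superlevel sets, by amounts that vanish at ties and are complete at gaps. After truncating the coordinates at half their maximum this is a continuous map [g] with [g t] in [W a] whenever [t a] is at least half the maximum. Starting instead from a point [x] common to all the [W a] with [t a > 0], the same flow joins [x] to [g t]: for a partition of unity [f] this gives [g (f x) ~ x]. Conversely a self-map [u] of the realization is homotopic to the identity as soon as the support of [u t] and the vertices where [t] exceeds half its maximum always span a simplex.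

Continuity is tested along filters, with realizations carrying the coordinatewise convergence of functions with a common finite support. *)
From Coquelicot Require Import Hierarchy.
From Stdlib Require Import Reals List Permutation Lra Lia Classical ClassicalEpsilon.
From Stdlib Require Import FunctionalExtensionality PropExtensionality.
Require Import Defs.
Open Scope R_scope.
Set Implicit Arguments.

(** * Limits of real functions along filters *)

Notation rlim F f l := (filterlim f F (@locally R_UniformSpace l)).

Lemma rlim_eps Z (F : (Z -> Prop) -> Prop) (FF : Filter F) (f : Z -> R) (l : R) :
  rlim F f l <-> forall eps, 0 < eps -> F (fun z => Rabs (f z - l) < eps).
Proof.
rewrite (@filterlim_locally Z R_UniformSpace F FF f l).
split; intros H.
- intros eps He. exact (H (mkposreal eps He)).
- intros eps. exact (H eps (cond_pos eps)).
Qed.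

Lemma rlim_ext Z (F : (Z -> Prop) -> Prop) (FF : Filter F) (f g : Z -> R) (l : R) :
  F (fun z => f z = g z) -> rlim F f l -> rlim F g l.
Proof. intros H Hf. exact (filterlim_ext_loc _ _ H Hf). Qed.

Lemma rlim_const Z (F : (Z -> Prop) -> Prop) (FF : Filter F) (l : R) : rlim F (fun _ => l) l.
Proof. apply filterlim_const. Qed.

Lemma rlim_comp Z (F : (Z -> Prop) -> Prop) (FF : Filter F) (f : Z -> R) (l : R) phi :
  continuity_pt phi l -> rlim F f l -> rlim F (fun z => phi (f z)) (phi l).
Proof.
intros Hc Hf. apply continuity_pt_filterlim in Hc.
exact (filterlim_comp _ _ _ _ _ _ _ _ Hf Hc).
Qed.

Lemma rlim_plus Z (F : (Z -> Prop) -> Prop) (FF : Filter F) (f g : Z -> R) (l m : R) :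
  rlim F f l -> rlim F g m -> rlim F (fun z => f z + g z) (l + m).
Proof.
intros Hf Hg. exact (filterlim_comp_2 f g Rplus Hf Hg (@filterlim_plus _ R_NormedModule l m)).
Qed.

Lemma rlim_mult Z (F : (Z -> Prop) -> Prop) (FF : Filter F) (f g : Z -> R) (l m : R) :
  rlim F f l -> rlim F g m -> rlim F (fun z => f z * g z) (l * m).
Proof.
intros Hf Hg. exact (filterlim_comp_2 f g Rmult Hf Hg (@filterlim_mult R_AbsRing l m)).
Qed.

Lemma rlim_opp Z (F : (Z -> Prop) -> Prop) (FF : Filter F) (f : Z -> R) (l : R) :
  rlim F f l -> rlim F (fun z => - f z) (- l).
Proof. apply rlim_comp; trivial. apply continuity_pt_opp, derivable_continuous_pt, derivable_pt_id. Qed.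

Lemma rlim_minus Z (F : (Z -> Prop) -> Prop) (FF : Filter F) (f g : Z -> R) (l m : R) :
  rlim F f l -> rlim F g m -> rlim F (fun z => f z - g z) (l - m).
Proof. intros Hf Hg. apply rlim_plus; trivial. now apply rlim_opp. Qed.

Lemma rlim_div Z (F : (Z -> Prop) -> Prop) (FF : Filter F) (f g : Z -> R) (l m : R) :
  m <> 0 -> rlim F f l -> rlim F g m -> rlim F (fun z => f z / g z) (l / m).
Proof.
intros Hm Hf Hg. apply rlim_mult; trivial.
apply (rlim_comp FF (phi := Rinv)); trivial.
apply (continuity_pt_inv id); trivial. apply derivable_continuous_pt, derivable_pt_id.
Qed.

Lemma rlim_max Z (F : (Z -> Prop) -> Prop) (FF : Filter F) (f g : Z -> R) (l m : R) :
  rlim F f l -> rlim F g m -> rlim F (fun z => Rmax (f z) (g z)) (Rmax l m).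
Proof.
rewrite !rlim_eps; trivial. intros Hf Hg eps He.
apply (filter_imp (fun z => Rabs (f z - l) < eps /\ Rabs (g z - m) < eps)).
- intros z [H1 H2]. apply Rabs_def2 in H1, H2. apply Rabs_def1;
  unfold Rmax; repeat destruct Rle_dec; lra.
- apply filter_and; auto.
Qed.

Lemma rlim_min Z (F : (Z -> Prop) -> Prop) (FF : Filter F) (f g : Z -> R) (l m : R) :
  rlim F f l -> rlim F g m -> rlim F (fun z => Rmin (f z) (g z)) (Rmin l m).
Proof.
rewrite !rlim_eps; trivial. intros Hf Hg eps He.
apply (filter_imp (fun z => Rabs (f z - l) < eps /\ Rabs (g z - m) < eps)).
- intros z [H1 H2]. apply Rabs_def2 in H1, H2. apply Rabs_def1;
  unfold Rmin; repeat destruct Rle_dec; lra.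
- apply filter_and; auto.
Qed.

Lemma rlim_lt Z (F : (Z -> Prop) -> Prop) (FF : Filter F) (f g : Z -> R) (l m : R) :
  rlim F f l -> rlim F g m -> l < m -> F (fun z => f z < g z).
Proof.
rewrite !rlim_eps; trivial. intros Hf Hg Hlm.
apply (filter_imp (fun z => Rabs (f z - l) < (m - l) / 2 /\ Rabs (g z - m) < (m - l) / 2)).
- intros z [H1 H2]. apply Rabs_def2 in H1, H2. lra.
- apply filter_and; [apply Hf | apply Hg]; lra.
Qed.

Lemma rlim_mono Z (F F' : (Z -> Prop) -> Prop) (f : Z -> R) (l : R) :
  (forall P, F P -> F' P) -> rlim F f l -> rlim F' f l.
Proof. intros H Hf P HP. apply H, Hf, HP. Qed.

Lemma within_weaken Z (F : (Z -> Prop) -> Prop) (FF : Filter F) (C P : Z -> Prop) :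
  F P -> within C F P.
Proof. unfold within. apply filter_imp. auto. Qed.

Lemma filter_true' Z (F : (Z -> Prop) -> Prop) (FF : Filter F) (P : Z -> Prop) :
  (forall z, P z) -> F P.
Proof. intros H. apply (filter_imp (fun _ => True)); auto. apply Hierarchy.filter_true. Qed.

Lemma filter_forall_in Z (F : (Z -> Prop) -> Prop) (FF : Filter F) T (l : list T) (Q : T -> Z -> Prop) :
  (forall t, In t l -> F (Q t)) -> F (fun z => forall t, In t l -> Q t z).
Proof.
induction l as [|t l IH]; intros H.
- apply filter_true'; trivial. intros z t [].
- apply (filter_imp (fun z => Q t z /\ forall t, In t l -> Q t z)).
  + intros z [H1 H2] t' [<-|H3]; auto.
  + apply filter_and; [apply H; left; trivial|]. apply IH. intros t' Ht. apply H; right; trivial.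
Qed.

(** * Convergence structures *)

(* Axiomatises the notions of convergence along filters for which continuity can be checked piecewise, on finitely many closed pieces. *)
Record convergence (Y : Type) := Convergence {
  conv : forall Z : Type, ((Z -> Prop) -> Prop) -> (Z -> Y) -> Y -> Prop;
  conv_mono : forall Z (F F' : (Z -> Prop) -> Prop) y y0,
    (forall P, F P -> F' P) -> conv F y y0 -> conv F' y y0;
  conv_ext : forall Z (F : (Z -> Prop) -> Prop) y y' y0, Filter F ->
    F (fun z => y z = y' z) -> conv F y y0 -> conv F y' y0;
  conv_const : forall Z (F : (Z -> Prop) -> Prop) y0, Filter F ->
    conv F (fun _ => y0) y0;
  conv_paste : forall Z (F : (Z -> Prop) -> Prop) (C D : Z -> Prop) y y0, Filter F ->
    F (fun z => C z \/ D z) ->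
    conv (within C F) y y0 -> conv (within D F) y y0 -> conv F y y0 }.

Arguments conv {Y} c {Z} F y y0.

(** A filter containing the empty set makes [y] eventually equal to the constant [y0]. In piecewise
    arguments this disposes of the pieces that do not accumulate at the limit. *)
Lemma conv_improper Y (cY : convergence Y) Z (F : (Z -> Prop) -> Prop) (FF : Filter F) y y0 :
  F (fun _ => False) -> conv cY F y y0.
Proof.
intros H. apply (@conv_ext Y cY Z F (fun _ => y0) y y0 FF).
- apply (filter_imp (fun _ => False)); tauto.
- apply conv_const; trivial.
Qed.

Lemma conv_paste_list Y (cY : convergence Y) Z (F : (Z -> Prop) -> Prop) (FF : Filter F) y y0
  T (l : list T) (C : T -> Z -> Prop) :
  F (fun z => exists t, In t l /\ C t z) ->
  (forall t, In t l -> conv cY (within (C t) F) y y0) -> conv cY F y y0.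
Proof.
revert F FF. induction l as [|t l IH]; intros F FF HF H.
- apply conv_improper; trivial. revert HF. apply filter_imp. intros z (t & [] & _).
- apply (@conv_paste Y cY Z F (C t) (fun z => exists t, In t l /\ C t z) y y0 FF).
  + revert HF. apply filter_imp. intros z (t' & [<-|H1] & H2); eauto.
  + apply H. left; trivial.
  + apply IH.
    * apply within_filter; trivial.
    * apply (filter_true' FF). trivial.
    * intros t' Ht'. eapply conv_mono; [|apply H; right; exact Ht'].
      intros P. unfold within. apply filter_imp. auto.
Qed.

(** Supplies the finite index set for pasting: one piece for each possible ordering of a support
    contained in [S]. Bounding the length first lets the lists be enumerated by induction. *)
Lemma NoDup_lists_finite T (S : list T) :
  exists LL : list (list T), forall L, NoDup L -> incl L S -> In L LL.
Proof.
assert (H : forall n, exists LL : list (list T), forall L, (length L <= n)%nat -> incl L S -> In L LL).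
{ induction n as [|n [LL IH]].
  - exists (nil :: nil). intros [|a L]; simpl; [auto|lia].
  - exists (nil :: flat_map (fun L => map (fun a => a :: L) S) LL).
    intros [|a L] HL HS; [left; trivial|right].
    apply in_flat_map. exists L. split.
    + apply IH; [simpl in HL; lia|]. intros b Hb. apply HS. right; trivial.
    + apply in_map_iff. exists a. split; trivial. apply HS. left; trivial. }
destruct (H (length S)) as [LL HL]. exists LL. intros L H1 H2. apply HL; trivial.
now apply NoDup_incl_length.
Qed.

(** * Finitely supported functions *)

Definition eq_dec_classical (T : Type) (x y : T) : {x = y} + {x <> y} :=
  excluded_middle_informative (x = y).

Definition supported (A : Type) (h : A -> R) (S : list A) : Prop :=
  forall a, h a <> 0 -> In a S.

Lemma supported_incl A (h : A -> R) S S' : incl S S' -> supported h S -> supported h S'.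
Proof. intros H1 H2 a Ha. apply H1, H2, Ha. Qed.

Lemma supported_zero A (h : A -> R) S a : supported h S -> ~ In a S -> h a = 0.
Proof. intros H Ha. apply NNPP. intros H'. apply Ha, H, H'. Qed.

Lemma supported_nodup A (h : A -> R) S :
  supported h S -> supported h (nodup (@eq_dec_classical A) S).
Proof. apply supported_incl. intros a Ha. now apply nodup_In. Qed.

Lemma lsum_app A (h : A -> R) l l' : lsum h (l ++ l') = lsum h l + lsum h l'.
Proof. unfold lsum. induction l as [|a l IH]; simpl; [|rewrite IH]; lra. Qed.

Lemma lsum_ext A (h k : A -> R) l : (forall a, In a l -> h a = k a) -> lsum h l = lsum k l.
Proof.
unfold lsum. induction l as [|a l IH]; simpl; intros H; trivial.
rewrite H, IH; auto.
Qed.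

Lemma lsum_zero A (h : A -> R) l : (forall a, In a l -> h a = 0) -> lsum h l = 0.
Proof.
unfold lsum. induction l as [|a l IH]; simpl; intros H; trivial. rewrite H, IH; auto; lra.
Qed.

Lemma lsum_plus A (h k : A -> R) l : lsum (fun a => h a + k a) l = lsum h l + lsum k l.
Proof. unfold lsum. induction l as [|a l IH]; simpl; [|rewrite IH]; lra. Qed.

Lemma lsum_scal A c (h : A -> R) l : lsum (fun a => c * h a) l = c * lsum h l.
Proof. unfold lsum. induction l as [|a l IH]; simpl; [|rewrite IH]; lra. Qed.

Lemma lsum_nonneg A (h : A -> R) l : (forall a, 0 <= h a) -> 0 <= lsum h l.
Proof. intros H. unfold lsum. induction l as [|a l IH]; simpl; [lra|]. specialize (H a). lra. Qed.

Lemma lsum_ge A (h : A -> R) l a : (forall a, 0 <= h a) -> In a l -> h a <= lsum h l.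
Proof.
intros H. unfold lsum. induction l as [|b l IH]; simpl; [tauto|].
intros [<-|Ha].
- pose proof (lsum_nonneg h l H). unfold lsum in *. lra.
- specialize (IH Ha). specialize (H b). lra.
Qed.

Lemma lsum_supported A (h : A -> R) S S' :
  NoDup S -> NoDup S' -> supported h S -> supported h S' -> lsum h S = lsum h S'.
Proof.
intros HS. revert S'. revert h. induction HS as [|a S Ha HS IH]; intros h S' HS' H H'.
- symmetry. apply lsum_zero. intros a _. apply (supported_zero a H). intros [].
- destruct (classic (In a S')) as [Hin|Hin].
  + destruct (in_split _ _ Hin) as (l1 & l2 & ->).
    (* [k] is [h] with its value at [a] erased, so that the induction hypothesis applies to [S']
       with [a] taken out. *)
    set (k := fun b => if excluded_middle_informative (b = a) then 0 else h b).
    assert (Hk : forall l, ~ In a l -> lsum h l = lsum k l).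
    { intros l Hl. apply lsum_ext. intros b Hb. unfold k.
      destruct excluded_middle_informative as [->|]; tauto. }
    assert (Hl := NoDup_remove_2 _ _ _ HS'). apply NoDup_remove_1 in HS'.
    rewrite lsum_app. change (h a + lsum h S = lsum h l1 + (h a + lsum h l2)).
    enough (lsum h S = lsum h (l1 ++ l2)) as -> by (rewrite lsum_app; lra).
    rewrite !Hk; trivial. apply IH; trivial.
    * intros b Hb. unfold k in Hb. destruct excluded_middle_informative as [|E]; [tauto|].
      destruct (H b Hb) as [->|]; tauto.
    * intros b Hb. unfold k in Hb. destruct excluded_middle_informative as [|E]; [tauto|].
      specialize (H' b Hb). rewrite in_app_iff in *. simpl in H'. intuition (subst; tauto).
  + change (h a + lsum h S = lsum h S'). rewrite (supported_zero a H' Hin), Rplus_0_l.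
    apply IH; trivial. intros b Hb. destruct (H b Hb) as [<-|]; trivial.
    elim Hb. now apply (supported_zero a H').
Qed.

(* Total sum; meaningless when the support is infinite, as for [fmax]. *)
Definition fsum (A : Type) (h : A -> R) : R :=
  lsum h (epsilon (inhabits nil) (fun S => NoDup S /\ supported h S)).

Lemma fsum_eq A (h : A -> R) S : NoDup S -> supported h S -> fsum h = lsum h S.
Proof.
intros H1 H2. unfold fsum.
destruct (epsilon_spec (inhabits nil) (fun S => NoDup S /\ supported h S)) as [H3 H4]; eauto.
now apply lsum_supported.
Qed.

Definition lmax (A : Type) (h : A -> R) (S : list A) : R := fold_right Rmax 0 (map h S).

Lemma lmax_ge A (h : A -> R) S a : In a S -> h a <= lmax h S.
Proof.
unfold lmax. induction S as [|b S IH]; simpl; [tauto|]. intros [<-|Ha].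
- apply Rmax_l.
- eapply Rle_trans; [apply IH; trivial|apply Rmax_r].
Qed.

Lemma lmax_nonneg A (h : A -> R) S : 0 <= lmax h S.
Proof.
unfold lmax. induction S as [|b S IH]; simpl; [lra|].
eapply Rle_trans; [exact IH|apply Rmax_r].
Qed.

Lemma lmax_attained A (h : A -> R) S : 0 < lmax h S -> exists a, In a S /\ h a = lmax h S.
Proof.
unfold lmax. induction S as [|b S IH]; simpl; [lra|]. intros H.
destruct (Rle_dec (fold_right Rmax 0 (map h S)) (h b)) as [E|E].
- exists b. split; [left; trivial|]. rewrite Rmax_left; lra.
- rewrite Rmax_right in * by lra. destruct (IH H) as (a & Ha & <-). exists a. auto.
Qed.

(** A positive maximum is attained at a vertex of the support, which lies in [S']; otherwise the
    default 0 in [lmax] suffices. *)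
Lemma lmax_supported A (h : A -> R) S S' :
  supported h S' -> lmax h S <= lmax h S'.
Proof.
intros H. destruct (Rle_lt_dec (lmax h S) 0) as [E|E].
- pose proof (lmax_nonneg h S'). lra.
- destruct (lmax_attained _ _ E) as (a & _ & Ha). rewrite <- Ha. apply lmax_ge, H. lra.
Qed.

Definition fmax (A : Type) (h : A -> R) : R :=
  lmax h (epsilon (inhabits nil) (supported h)).

Lemma fmax_eq A (h : A -> R) S : supported h S -> fmax h = lmax h S.
Proof.
intros H. assert (H' := epsilon_spec (inhabits nil) (supported h) (ex_intro _ S H)).
apply Rle_antisym; now apply lmax_supported.
Qed.

Lemma fmax_ge A (h : A -> R) S a : supported h S -> h a <= fmax h.
Proof.
intros H. rewrite (fmax_eq H). destruct (Req_dec (h a) 0) as [E|E].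
- rewrite E. apply lmax_nonneg.
- apply lmax_ge, H, E.
Qed.

Lemma fmax_attained A (h : A -> R) S b :
  supported h S -> 0 < h b -> 0 < fmax h /\ exists a, h a = fmax h.
Proof.
intros H Hb. pose proof (fmax_ge b H) as Hm. split; [lra|].
rewrite (fmax_eq H) in *. destruct (lmax_attained h S) as (a & _ & Ha); [lra|]. eauto.
Qed.

(** The common finite support is what separates this from pointwise convergence: it confines the
    points to finitely many simplices, where sums and maxima pass to the limit. *)
Definition fconv (A Z : Type) (F : (Z -> Prop) -> Prop) (t : Z -> A -> R) (t0 : A -> R) : Prop :=
  (forall a, rlim F (fun z => t z a) (t0 a)) /\
  exists S, supported t0 S /\ F (fun z => supported (t z) S).

Lemma fconv_NoDup A Z (F : (Z -> Prop) -> Prop) (FF : Filter F) (t : Z -> A -> R) t0 :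
  fconv F t t0 -> exists S, NoDup S /\ supported t0 S /\ F (fun z => supported (t z) S).
Proof.
intros (_ & S & H1 & H2). exists (nodup (@eq_dec_classical A) S). split; [apply NoDup_nodup|].
split; [now apply supported_nodup|]. revert H2. apply filter_imp. intros z. apply supported_nodup.
Qed.

Lemma rlim_fsum A Z (F : (Z -> Prop) -> Prop) (FF : Filter F) (t : Z -> A -> R) t0 :
  fconv F t t0 -> rlim F (fun z => fsum (t z)) (fsum t0).
Proof.
intros H. destruct (fconv_NoDup FF H) as (S & HS & H1 & H2). destruct H as [H _].
rewrite (fsum_eq HS H1). apply (@rlim_ext _ F FF (fun z => lsum (t z) S)).
{ revert H2. apply filter_imp. intros z Hz. now rewrite (fsum_eq HS Hz). }
clear H1 H2 HS. unfold lsum. induction S as [|a S IH]; simpl.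
- now apply rlim_const.
- now apply rlim_plus.
Qed.

Lemma rlim_fmax A Z (F : (Z -> Prop) -> Prop) (FF : Filter F) (t : Z -> A -> R) t0 :
  fconv F t t0 -> rlim F (fun z => fmax (t z)) (fmax t0).
Proof.
intros (H & S & H1 & H2).
rewrite (fmax_eq H1). apply (@rlim_ext _ F FF (fun z => lmax (t z) S)).
{ revert H2. apply filter_imp. intros z Hz. now rewrite (fmax_eq Hz). }
clear H1 H2. unfold lmax. induction S as [|a S IH]; simpl.
- now apply rlim_const.
- now apply rlim_max.
Qed.

(** * Lists of vertices in ascending order of height *)

Fixpoint ascending (A : Type) (h : A -> R) (p : R) (L : list A) : Prop :=
  match L with nil => True | a :: L' => p <= h a /\ ascending h (h a) L' end.

Lemma ascending_ge A (h : A -> R) p L a : ascending h p L -> In a L -> p <= h a.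
Proof.
revert p. induction L as [|b L IH]; simpl; [tauto|]. intros p [H1 H2] [<-|Ha]; trivial.
specialize (IH _ H2 Ha). lra.
Qed.

Lemma ascending_insert A (h : A -> R) p L a : p <= h a -> ascending h p L ->
  exists l1 l2, L = l1 ++ l2 /\ ascending h p (l1 ++ a :: l2).
Proof.
revert p. induction L as [|b L IH]; intros p Hp HL.
- exists nil, nil. simpl. auto.
- destruct HL as [H1 H2]. destruct (Rle_lt_dec (h a) (h b)) as [E|E].
  + exists nil, (b :: L). simpl. auto.
  + destruct (IH (h b)) as (l1 & l2 & -> & H); [lra|trivial|].
    exists (b :: l1), l2. simpl. auto.
Qed.

Lemma ascending_exists A (h : A -> R) S : (forall a, 0 <= h a) -> supported h S ->
  exists L, NoDup L /\ ascending h 0 L /\ forall a, In a L <-> h a <> 0.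
Proof.
intros Hh HS.
enough (H : exists L, NoDup L /\ ascending h 0 L /\ forall a, In a L <-> In a S /\ h a <> 0).
{ destruct H as (L & H1 & H2 & H3). exists L. repeat split; trivial.
  - intros Ha. now apply H3.
  - intros Ha. apply H3. split; trivial. now apply HS. }
clear HS. induction S as [|b S (L & H1 & H2 & H3)].
- exists nil. simpl. split; [constructor|]. tauto.
- destruct (classic (In b L \/ h b = 0)) as [E|E].
  + exists L. split; [trivial|]. split; [trivial|]. intros a. rewrite H3. simpl.
    split; [tauto|]. intros [[<-|Ha] Hb]; [|tauto]. apply H3. tauto.
  + destruct (ascending_insert h L b (Hh b) H2) as (l1 & l2 & -> & H).
    exists (l1 ++ b :: l2). split; [|split; trivial].
    * apply (Permutation_NoDup (l := b :: l1 ++ l2)).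
      -- apply Permutation_middle.
      -- constructor; tauto.
    * intros a. specialize (H3 a). rewrite in_app_iff in *. simpl.
      destruct (classic (b = a)) as [<-|]; [|tauto]. tauto.
Qed.

Lemma ascending_shift A (h : A -> R) b p L :
  ascending (fun a => b + h a) (b + p) L <-> ascending h p L.
Proof.
revert p. induction L as [|a L IH]; simpl; intros p; [tauto|]. rewrite IH. intuition lra.
Qed.

(** Weak inequalities survive limits: a strict inequality the other way at the limit would hold
    eventually and make the filter improper. *)
Lemma ascending_lim A Z (F : (Z -> Prop) -> Prop) (FF : Filter F) (h : Z -> A -> R) h0 p p0 L :
  ~ F (fun _ => False) ->
  (forall a, rlim F (fun z => h z a) (h0 a)) -> rlim F p p0 ->
  F (fun z => ascending (h z) (p z) L) -> ascending h0 p0 L.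
Proof.
intros HF Hh. revert p p0. induction L as [|a L IH]; intros p p0 Hp H; simpl; trivial.
split.
- apply Rnot_lt_le. intros E. apply HF.
  generalize (filter_and _ _ (rlim_lt FF (Hh a) Hp E) H). apply filter_imp.
  intros z [H1 [H2 _]]. lra.
- apply (IH (fun z => h z a)); trivial. revert H. apply filter_imp. intros z [_ H]. exact H.
Qed.

(** * Iterated contractions *)

(** [c] is a total function, but it is constrained only on [P] and for times in the unit interval;
    this avoids carrying membership proofs through the iteration. The point [q] also records that
    [P] is inhabited. *)
Record contracts (Y : Type) (cY : convergence Y) (P : Y -> Prop) (c : Y -> R -> Y) : Prop := {
  contracts_in : forall y s, P y -> 0 <= s <= 1 -> P (c y s);
  contracts_0 : forall y, P y -> c y 0 = y;
  contracts_1 : exists q, P q /\ forall y, P y -> c y 1 = q;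
  contracts_conv : forall Z (F : (Z -> Prop) -> Prop), Filter F ->
    forall (y : Z -> Y) y0 (s : Z -> R) s0,
    F (fun z => P (y z)) -> P y0 -> conv cY F y y0 ->
    F (fun z => 0 <= s z <= 1) -> 0 <= s0 <= 1 -> rlim F s s0 ->
    conv cY F (fun z => c (y z) (s z)) (c y0 s0) }.

Definition meet (A Y : Type) (W : A -> Y -> Prop) (L : list A) (y : Y) : Prop :=
  forall a, In a L -> W a y.

Lemma meet_incl A Y (W : A -> Y -> Prop) L L' y : incl L' L -> meet W L y -> meet W L' y.
Proof. intros H1 H2 a Ha. apply H2, H1, Ha. Qed.

Lemma meet_tail A Y (W : A -> Y -> Prop) a L y : meet W (a :: L) y -> meet W L y.
Proof. apply meet_incl. intros b. now right. Qed.

(* Passing from height [p] to height [v], this is the fraction of a contraction to be performed: none if [v = p], and all of it as soon as [v >= 2 * p]. *)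
Definition progress (p v : R) : R := Rmin 1 (2 * ((v - p) / v)).

Lemma progress_range p v : 0 <= p <= v -> 0 <= progress p v <= 1.
Proof.
intros H. unfold progress. split; [|apply Rmin_l].
apply Rmin_glb; [lra|]. destruct (Req_dec v 0) as [->|E].
- replace (0 - p) with 0 by lra. unfold Rdiv. rewrite Rmult_0_l. lra.
- apply Rmult_le_pos; [lra|]. apply Rle_mult_inv_pos; lra.
Qed.

Lemma progress_same v : progress v v = 0.
Proof.
unfold progress, Rdiv. rewrite Rminus_diag, Rmult_0_l, Rmult_0_r. apply Rmin_right. lra.
Qed.

Lemma progress_full p v : 2 * p <= v -> 0 < v -> progress p v = 1.
Proof.
intros H Hv. unfold progress. apply Rmin_left.
replace (2 * ((v - p) / v)) with (1 + (v - 2 * p) / v) by (field; lra).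
assert (0 <= (v - 2 * p) / v) by (apply Rle_mult_inv_pos; lra). lra.
Qed.

(** The choice depends on the predicate [P] alone, so lists with the same vertices in different
    orders use the same contraction. *)
Definition contraction (Y : Type) (cY : convergence Y) (P : Y -> Prop) : Y -> R -> Y :=
  epsilon (inhabits (fun y _ => y)) (contracts cY P).

(** [L] is meant to be ascending for [h], so its tails are superlevel sets up to ties. Each step
    moves inside the intersection over all remaining vertices, and its result still lies in the
    larger intersection over the tail. *)
Fixpoint flow (A Y : Type) (cY : convergence Y) (W : A -> Y -> Prop) (L : list A)
    (h : A -> R) (p : R) (y : Y) : Y :=
  match L with
  | nil => y
  | a :: L' => flow cY W L' h (h a) (contraction cY (meet W L) y (progress p (h a)))
  end.

Section Flow.

Variables (A Y : Type) (cY : convergence Y) (W : A -> Y -> Prop) (K : list A -> Prop).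
Hypothesis K_incl : forall s s', incl s' s -> K s -> K s'.
Hypothesis K_contractible : forall L, L <> nil -> K L -> exists c, contracts cY (meet W L) c.

Lemma contraction_spec a L : K (a :: L) -> contracts cY (meet W (a :: L)) (contraction cY (meet W (a :: L))).
Proof. intros H. unfold contraction. apply epsilon_spec, K_contractible; trivial. discriminate. Qed.

Lemma K_tail a L : K (a :: L) -> K L.
Proof. apply K_incl. intros b. now right. Qed.

Lemma contraction_meet a L p h y : K (a :: L) -> 0 <= p <= h -> meet W (a :: L) y ->
  meet W (a :: L) (contraction cY (meet W (a :: L)) y (progress p h)).
Proof. intros H1 H2 H3. apply (contracts_in (contraction_spec H1)); trivial. now apply progress_range. Qed.

Lemma flow_tie a L h p y : K (a :: L) -> meet W (a :: L) y -> h a = p ->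
  flow cY W (a :: L) h p y = flow cY W L h p y.
Proof.
intros H1 H2 H3. simpl. rewrite H3, progress_same, (contracts_0 (contraction_spec H1)); trivial.
Qed.

Lemma flow_flat L h p y : K L -> meet W L y -> (forall a, In a L -> h a = p) ->
  flow cY W L h p y = y.
Proof.
induction L as [|a L IH]; intros H1 H2 H3; trivial.
rewrite flow_tie; trivial.
- apply IH; [now apply (K_tail H1)|now apply (meet_tail H2)|]. intros b Hb. apply H3. now right.
- apply H3. now left.
Qed.

(** The moving point stays in [W a] as long as [a] is in the remaining list. Once a vertex of top
    height has been treated, the remaining ones tie with it and nothing moves any more. *)
Lemma flow_top L h p y a : K L -> meet W L y -> 0 <= p -> ascending h p L ->
  In a L -> (forall b, In b L -> h b <= h a) -> W a (flow cY W L h p y).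
Proof.
revert p y. induction L as [|b L IH]; intros p y H1 H2 Hp H3 Ha H4; [destruct Ha|].
destruct H3 as [H3 H3']. simpl. set (y' := contraction _ _ _ _).
assert (Hy : meet W (b :: L) y') by now apply contraction_meet.
assert (HL := meet_tail Hy).
destruct (classic (In a L)) as [E|E].
- apply IH; trivial; [now apply (K_tail H1)|lra|]. intros c Hc. apply H4. now right.
- destruct Ha as [<-|Ha]; [|tauto]. rewrite flow_flat; trivial.
  + apply Hy. now left.
  + now apply (K_tail H1).
  + intros c Hc. apply Rle_antisym; [apply H4; now right|]. now apply (@ascending_ge _ _ _ _ _ H3').
Qed.

(** Vertices of height 0 do nothing. The first positive height is at least twice the previous height
    0, so its contraction is complete and sends both points to the same [q]. *)
Lemma flow_reset L h y y' : K L -> meet W L y -> meet W L y' -> ascending h 0 L ->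
  (exists a, In a L /\ 0 < h a) -> flow cY W L h 0 y = flow cY W L h 0 y'.
Proof.
induction L as [|a L IH]; intros H1 H2 H3 H4 (b & Hb & Hb'); [destruct Hb|].
destruct H4 as [H4 H4'].
destruct H4 as [H4|H4].
- simpl. rewrite progress_full by lra.
  destruct (contracts_1 (contraction_spec H1)) as (q & _ & Hq). now rewrite !Hq.
- rewrite !flow_tie by (trivial; lra). apply IH.
  + now apply (K_tail H1).
  + now apply (meet_tail H2).
  + now apply (meet_tail H3).
  + now rewrite H4.
  + destruct Hb as [<-|Hb]; [lra|eauto].
Qed.

(** Heads of height [p] are dropped by [flow_tie]. When both heads are higher, the two lists have
    the same vertices, hence the same least height and the same contraction. The heads may still be
    different vertices, but they tie, so the tails agree above the new height. This removes the
    dependence on how ties are ordered. *)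
Lemma flow_unique L L' h p y : K L -> K L' -> meet W L y -> meet W L' y -> 0 <= p ->
  ascending h p L -> ascending h p L' ->
  (forall a, p < h a -> In a L <-> In a L') ->
  flow cY W L h p y = flow cY W L' h p y.
Proof.
remember (length L + length L')%nat as n eqn:Hn.
assert (Hn' : (length L + length L' <= n)%nat) by lia. clear Hn.
revert L L' p y Hn'. induction n as [|n IH]; intros L L' p y Hn HK HK' Hy Hy' Hp HL HL' H.
{ destruct L, L'; simpl in Hn; trivial; lia. }
destruct L as [|a L].
{ rewrite (@flow_flat L'); trivial. intros a Ha. apply Rle_antisym; [|now apply (@ascending_ge _ _ _ _ _ HL')].
  apply Rnot_lt_le. intros E. now apply (H a E) in Ha. }
destruct L' as [|a' L'].
{ rewrite (@flow_flat (a :: L)); trivial.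
  intros b Hb. apply Rle_antisym; [|now apply (@ascending_ge _ _ _ _ _ HL)].
  apply Rnot_lt_le. intros E. now apply (H b E) in Hb. }
destruct (proj1 HL) as [Ha|Ha].
2:{ rewrite flow_tie by (trivial; lra). apply IH; trivial; [simpl in *; lia| | | |].
  - now apply (K_tail HK).
  - now apply (meet_tail Hy).
  - rewrite Ha. apply HL.
  - intros b Hb. rewrite <- H by trivial. simpl. intuition (subst; lra). }
destruct (proj1 HL') as [Ha'|Ha'].
2:{ rewrite (@flow_tie a') by (trivial; lra). apply IH; trivial; [simpl in *; lia| | | |].
  - now apply (K_tail HK').
  - now apply (meet_tail Hy').
  - rewrite Ha'. apply HL'.
  - intros b Hb. rewrite H by trivial. simpl. intuition (subst; lra). }
assert (Hgt : forall b, In b (a :: L) -> h a <= h b).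
{ intros b [<-|Hb]; [lra|]. apply (@ascending_ge _ _ _ _ _ (proj2 HL) Hb). }
assert (Hgt' : forall b, In b (a' :: L') -> h a' <= h b).
{ intros b [<-|Hb]; [lra|]. apply (@ascending_ge _ _ _ _ _ (proj2 HL') Hb). }
assert (Hset : forall b, In b (a :: L) <-> In b (a' :: L')).
{ intros b. split; intros Hb; apply H; trivial.
  - specialize (Hgt b Hb). lra.
  - specialize (Hgt' b Hb). lra. }
assert (Haa : h a = h a').
{ apply Rle_antisym.
  - apply Hgt, Hset. now left.
  - apply Hgt', Hset. now left. }
assert (HW : meet W (a :: L) = meet W (a' :: L')).
{ apply functional_extensionality. intros x. apply propositional_extensionality.
  unfold meet. split; intros Hx b Hb; apply Hx, Hset, Hb. }
simpl. rewrite <- HW, <- Haa. set (y' := contraction _ _ _ _).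
assert (Hy1 : meet W (a :: L) y') by (apply contraction_meet; trivial; lra).
apply IH; [simpl in *; lia| | | | |lra|apply HL| |].
- now apply (K_tail HK).
- now apply (K_tail HK').
- now apply (meet_tail Hy1).
- rewrite HW in Hy1. now apply (meet_tail Hy1).
- rewrite Haa. apply HL'.
- intros b Hb. specialize (Hset b). simpl in Hset. rewrite Haa in Hb at 1.
  split; intros Hb'; destruct Hset as [S1 S2].
  + destruct S1 as [<-|]; auto; lra.
  + destruct S2 as [<-|]; auto; lra.
Qed.

(* Where the lowest height tends to 0, the first complete contraction makes the starting point irrelevant. *)
Lemma flow_conv L : K L -> forall Z (F : (Z -> Prop) -> Prop), Filter F ->
  forall (h : Z -> A -> R) (h0 : A -> R) (p : Z -> R) (p0 : R) y y0,
  (forall a, rlim F (fun z => h z a) (h0 a)) -> rlim F p p0 ->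
  F (fun z => 0 <= p z /\ ascending (h z) (p z) L) -> 0 <= p0 -> ascending h0 p0 L ->
  F (fun z => meet W L (y z)) -> meet W L y0 ->
  (p0 = 0 /\ (exists a, In a L /\ 0 < h0 a)) \/ (0 < p0 /\ conv cY F y y0) ->
  conv cY F (fun z => flow cY W L (h z) (p z) (y z)) (flow cY W L h0 p0 y0).
Proof.
induction L as [|a L IH]; intros HK Z F FF h h0 p p0 y y0 Hh Hp HF Hp0 H0 Hy Hy0 Hcase.
{ destruct Hcase as [(_ & a & [] & _)|[_ H]]. exact H. }
simpl. destruct H0 as [Ha H0].
assert (Hc := contraction_spec HK). set (c := contraction cY (meet W (a :: L))) in *.
assert (Hc0 : meet W (a :: L) (c y0 (progress p0 (h0 a)))) by (apply contraction_meet; trivial; lra).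
apply IH; trivial.
- now apply (K_tail HK).
- revert HF. apply filter_imp. simpl. intros z. intuition lra.
- lra.
- generalize (filter_and _ _ HF Hy). apply filter_imp. intros z [[H1 [H2 H3]] H4].
  apply (@meet_tail _ _ W a). apply contraction_meet; trivial; lra.
- now apply (meet_tail Hc0).
(* Three cases. If the limit height is still 0, convergence of the moving point is not yet claimed.
   If it jumps from 0 to a positive value, the contraction is eventually complete and the point is
   constantly [q]. If it was already positive, the denominator in [progress] stays away from 0 and
   everything is continuous. *)
- destruct (Req_dec (h0 a) 0) as [E|E].
  + left. split; trivial. destruct Hcase as [(_ & b & [<-|Hb] & Hb')|[H _]]; [lra| |lra]. eauto.
  + right. split; [lra|]. destruct (Req_dec p0 0) as [E'|E'].
    * destruct (contracts_1 Hc) as (q & _ & Hq).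
      rewrite (@progress_full p0 (h0 a)) by lra. rewrite (Hq y0 Hy0).
      apply (@conv_ext _ cY Z F (fun _ => q)); [trivial| |now apply conv_const].
      assert (H2p : rlim F (fun z => 2 * p z) (2 * p0)).
      { apply (rlim_mult FF (f := fun _ => 2)); trivial. now apply rlim_const. }
      assert (H1 := rlim_lt FF H2p (Hh a) ltac:(lra)).
      generalize (filter_and _ _ H1 (filter_and _ _ HF Hy)). apply filter_imp.
      intros z [H2 [[H3 H4] H5]]. rewrite progress_full by lra. now rewrite Hq.
    * assert (Hcv : conv cY F y y0) by (destruct Hcase; tauto).
      apply (contracts_conv Hc); trivial.
      -- revert HF. apply filter_imp. simpl. intros z Hz. apply progress_range. lra.
      -- apply progress_range. lra.
      -- apply rlim_min; [trivial|now apply rlim_const|].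
         apply (rlim_mult FF (f := fun _ => 2)); [now apply rlim_const|].
         apply rlim_div; trivial. now apply rlim_minus.
Qed.

End Flow.

(** * Maps carried by a family of contractible intersections *)

Lemma proper_const Z (F : (Z -> Prop) -> Prop) (FF : Filter F) (P : Prop) :
  ~ F (fun _ => False) -> F (fun _ => P) -> P.
Proof.
intros H1 H2. apply NNPP. intros HP. apply H1. revert H2. apply filter_imp. tauto.
Qed.

Lemma fconv_mono A Z (F F' : (Z -> Prop) -> Prop) (t : Z -> A -> R) t0 :
  (forall P, F P -> F' P) -> fconv F t t0 -> fconv F' t t0.
Proof.
intros H (H1 & S & H2 & H3). split; [|eauto]. intros a. now apply rlim_mono with (1 := H).
Qed.

Definition sorted_support (A : Type) (t : A -> R) : list A :=
  epsilon (inhabits nil) (fun L => NoDup L /\ ascending t 0 L /\ forall a, In a L <-> t a <> 0).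

Lemma sorted_support_spec A (t : A -> R) S : (forall a, 0 <= t a) -> supported t S ->
  NoDup (sorted_support t) /\ ascending t 0 (sorted_support t) /\
  forall a, In a (sorted_support t) <-> t a <> 0.
Proof.
intros H1 H2. unfold sorted_support. apply epsilon_spec. now apply ascending_exists with S.
Qed.

Section CarriedMap.

Variables (A Y : Type) (cY : convergence Y) (W : A -> Y -> Prop) (K : list A -> Prop).
Hypothesis K_incl : forall s s', incl s' s -> K s -> K s'.
Hypothesis K_contractible : forall L, L <> nil -> K L -> exists c, contracts cY (meet W L) c.

(** All coordinates are raised by the baseline [b], from which the flow starts. With [b = 0] the
    first contraction is complete and forgets [y]; a positive baseline keeps the dependence on [y]
    continuous. *)
Definition drift (t : A -> R) (b : R) (y : Y) : Y :=
  flow cY W (sorted_support t) (fun a => b + t a) b y.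

(** Vertices of [L] outside the support sit at the starting height and have no effect, by
    [flow_unique]. Hence a list adapted to nearby points also computes the drift at the limit, where
    some coordinates may have become 0. *)
Lemma drift_flow t b y L : (forall a, 0 <= t a) -> 0 <= b -> K L -> meet W L y ->
  ascending t 0 L -> supported t L ->
  drift t b y = flow cY W L (fun a => b + t a) b y.
Proof.
intros Ht Hb HK Hy HL HS. destruct (sorted_support_spec Ht HS) as (_ & H1 & H2).
assert (Hincl : incl (sorted_support t) L) by (intros a Ha; now apply HS, H2).
assert (Hasc : forall L', ascending t 0 L' -> ascending (fun a => b + t a) b L').
{ intros L' HL'. apply (ascending_shift t b) in HL'. now rewrite Rplus_0_r in HL'. }
apply flow_unique with K; auto.
- now apply K_incl with L.
- now apply meet_incl with L.
- intros a Ha. rewrite H2. split; intros; [apply HS|]; lra.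
Qed.

Lemma drift_reset t y y' S : (forall a, 0 <= t a) -> supported t S -> (exists a, t a <> 0) ->
  (forall L, (forall a, In a L -> t a <> 0) -> K L) ->
  (forall a, t a <> 0 -> W a y) -> (forall a, t a <> 0 -> W a y') ->
  drift t 0 y = drift t 0 y'.
Proof.
intros Ht HS [a Ha] HK Hy Hy'. destruct (sorted_support_spec Ht HS) as (_ & H1 & H2).
apply flow_reset with K; trivial.
- apply HK. intros b. apply H2.
- intros b Hb. now apply Hy, H2.
- intros b Hb. now apply Hy', H2.
- apply (ascending_shift t 0) in H1. now rewrite Rplus_0_r in H1.
- exists a. split; [now apply H2|]. specialize (Ht a). lra.
Qed.

(** The filter is cut into finitely many pieces, one per ordering [L] of the support of [t z]. On a
    piece the list is fixed and passes to the limit: [t0] is ascending along [L] and supported in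
    it. Then [flow_conv] applies. *)
Lemma drift_conv Z (F : (Z -> Prop) -> Prop) (FF : Filter F)
    (t : Z -> A -> R) t0 (b : Z -> R) (b0 : R) y y0 :
  F (fun z => forall a, 0 <= t z a) -> (forall a, 0 <= t0 a) -> fconv F t t0 ->
  F (fun z => 0 <= b z) -> 0 <= b0 -> rlim F b b0 ->
  F (fun z => forall L, (forall a, In a L -> t z a <> 0) -> K L) ->
  (forall L, (forall a, In a L -> t0 a <> 0) -> K L) ->
  F (fun z => forall a, t z a <> 0 -> W a (y z)) -> (forall a, t0 a <> 0 -> W a y0) ->
  (b0 = 0 /\ (exists a, t0 a <> 0)) \/
  (0 < b0 /\ conv cY F y y0 /\ forall a, ~ W a y0 -> F (fun z => t z a = 0)) ->
  conv cY F (fun z => drift (t z) (b z) (y z)) (drift t0 b0 y0).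
Proof.
intros Ht Ht0 Hconv Hb Hb0 Hbl HK HK0 Hy Hy0 Hcase.
destruct Hconv as [Hl (S & HS0 & HS)].
destruct (NoDup_lists_finite S) as [LL HLL].
apply (@conv_paste_list _ cY Z F FF _ _ _ LL
  (fun L z => ascending (t z) 0 L /\ forall a, In a L <-> t z a <> 0)).
{ generalize (filter_and _ _ Ht HS). apply filter_imp. intros z [Htz Hz].
  destruct (sorted_support_spec Htz Hz) as (H1 & H2 & H3).
  exists (sorted_support (t z)). split; [|auto]. apply HLL; trivial.
  intros a Ha. now apply Hz, H3. }
intros L _. set (C := fun z => _).
assert (HC : within C F C) by (apply (@filter_true' Z F FF (fun z => C z -> C z)); auto).
assert (FF' := within_filter _ C F FF).
destruct (classic (within C F (fun _ => False))) as [Him|Hproper].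
{ now apply conv_improper. }
assert (HF := fun P => @within_weaken Z F FF C P).
assert (HLK : K L).
{ apply (@proper_const Z (within C F) FF' _ Hproper). generalize (filter_and _ _ HC (HF _ HK)). apply filter_imp.
  intros z [[_ H1] H2]. apply H2. intros a. apply H1. }
assert (HL0 : ascending t0 0 L).
{ apply (@ascending_lim _ Z (within C F) FF' t t0 (fun _ => 0) 0 L Hproper).
  - intros a. now apply rlim_mono with (1 := HF).
  - now apply rlim_const.
  - revert HC. apply filter_imp. intros z [H _]. exact H. }
assert (HLS : supported t0 L).
{ intros a Ha. apply (@proper_const Z (within C F) FF' _ Hproper).
  assert (H1 := rlim_lt FF (@rlim_const Z F FF 0) (Hl a) ltac:(specialize (Ht0 a); lra)).
  generalize (filter_and _ _ HC (HF _ H1)). apply filter_imp.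
  intros z [[_ H2] H3]. apply H2. lra. }
assert (HyL : within C F (fun z => meet W L (y z))).
{ generalize (filter_and _ _ HC (HF _ Hy)). apply filter_imp.
  intros z [[_ H2] H3] a Ha. now apply H3, H2. }
(* [L] may contain vertices where [t0] vanishes, and [y0] need not lie in their sets. If [b0 = 0],
   the start is replaced by a point [q] of the whole intersection, harmlessly by [drift_reset]. If
   [b0 > 0], a vertex [a] of [L] with [y0] outside [W a] would have [t z a] eventually 0, which is
   impossible on a proper piece. *)
assert (Hstart : exists y1, meet W L y1 /\ drift t0 b0 y0 = drift t0 b0 y1 /\
  ((b0 = 0 /\ (exists a, t0 a <> 0)) \/ (0 < b0 /\ conv cY (within C F) y y1))).
{ destruct Hcase as [[-> [a Ha]]|(H1 & H2 & H3)].
  - assert (HaL := HLS a Ha).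
    assert (Hne : L <> nil) by (intros ->; destruct HaL).
    destruct (K_contractible Hne HLK) as [c Hc]. destruct (contracts_1 Hc) as (q & Hq & _).
    exists q. split; trivial. split; [|eauto].
    apply (@drift_reset t0 y0 q L); eauto.
  - exists y0. split; [|split; [trivial|right; split; trivial]].
    + intros a Ha. apply NNPP. intros Hn. apply Hproper.
      generalize (filter_and _ _ HC (HF _ (H3 a Hn))). apply filter_imp.
      intros z [[_ H4] H5]. now apply H4 in Ha.
    + now apply conv_mono with F. }
destruct Hstart as (y1 & Hy1 & -> & Hcase').
rewrite (@drift_flow t0 b0 y1 L); trivial.
apply (@conv_ext _ cY Z (within C F) (fun z => flow cY W L (fun a => b z + t z a) (b z) (y z))); trivial.
{ generalize (filter_and _ _ (filter_and _ _ (HF _ Ht) HC) (filter_and _ _ (HF _ Hb) HyL)).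
  apply filter_imp. intros z [[H0 [H1 H2]] [H3 H4]]. symmetry. apply drift_flow; trivial. intros a. apply H2. }
apply flow_conv with K; trivial.
- intros a. apply rlim_plus; trivial; now apply rlim_mono with (1 := HF).
- now apply rlim_mono with (1 := HF).
- generalize (filter_and _ _ HC (HF _ Hb)). apply filter_imp. intros z [[H1 _] H2].
  split; trivial. apply (ascending_shift (t z) (b z)) in H1. now rewrite Rplus_0_r in H1.
- apply (ascending_shift t0 b0) in HL0. now rewrite Rplus_0_r in HL0.
- destruct Hcase' as [[-> [a Ha]]|H]; [left|now right]. split; trivial.
  exists a. split; [now apply HLS|]. specialize (Ht0 a). lra.
Qed.

End CarriedMap.

(** * Points and convergence in a realization *)

Lemma fconv_ext A Z (F : (Z -> Prop) -> Prop) (FF : Filter F) (t t' : Z -> A -> R) t0 :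
  F (fun z => t z = t' z) -> fconv F t t0 -> fconv F t' t0.
Proof.
intros H (H1 & S & H2 & H3). split.
- intros a. apply (@rlim_ext _ F FF (fun z => t z a)); trivial.
  revert H. apply filter_imp. intros z Hz. now rewrite Hz.
- exists S. split; trivial. generalize (filter_and _ _ H H3). apply filter_imp.
  intros z [Hz H4]. now rewrite <- Hz.
Qed.

Lemma fconv_paste A Z (F : (Z -> Prop) -> Prop) (FF : Filter F) (C D : Z -> Prop)
    (t : Z -> A -> R) t0 :
  F (fun z => C z \/ D z) -> fconv (within C F) t t0 -> fconv (within D F) t t0 -> fconv F t t0.
Proof.
intros H (H1 & S1 & H2 & H3) (H1' & S2 & H2' & H3'). split.
- intros a. specialize (H1 a). specialize (H1' a).
  rewrite rlim_eps in * by (trivial; now apply within_filter).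
  unfold within in *. intros eps He.
  generalize (filter_and _ _ H (filter_and _ _ (H1 eps He) (H1' eps He))). apply filter_imp. tauto.
- exists (S1 ++ S2). unfold within in *. split.
  + apply supported_incl with S1; trivial. now apply incl_appl, incl_refl.
  + generalize (filter_and _ _ H (filter_and _ _ H3 H3')). apply filter_imp.
    intros z [[Hz|Hz] [H4 H5]].
    * apply supported_incl with S1; auto. now apply incl_appl, incl_refl.
    * apply supported_incl with S2; auto. now apply incl_appr, incl_refl.
Qed.

(* Finer than convergence in the weak topology, hence enough to test continuity of maps into a realization. *)
Definition conv_realization (A : Type) (K : list A -> Prop) : convergence (pt (realization K)).
Proof.
refine (@Convergence _ (fun Z F y y0 => fconv F (fun z => proj1_sig (y z)) (proj1_sig y0)) _ _ _ _).
- intros Z F F' y y0. apply fconv_mono.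
- intros Z F y y' y0 FF H. apply fconv_ext; trivial. revert H. apply filter_imp.
  intros z Hz. now rewrite Hz.
- intros Z F y0 FF. split.
  + intros a. now apply rlim_const.
  + destruct (proj2_sig y0) as (_ & S & _ & _ & HS & _). exists S. split; trivial.
    now apply filter_true'.
- intros Z F C D y y0 FF. now apply fconv_paste.
Defined.

Section Realization.

Variables (A : Type) (K : list A -> Prop).
Hypothesis K_incl : forall s s', incl s' s -> K s -> K s'.

Lemma rpoint_intro (t : A -> R) S : (forall a, 0 <= t a) -> K S -> supported t S ->
  fsum t = 1 -> is_rpoint K t.
Proof.
intros H1 H2 H3 H4. split; trivial. exists (nodup (@eq_dec_classical A) S).
assert (HN := NoDup_nodup (@eq_dec_classical A) S). assert (HS := supported_nodup H3).
split; [trivial|]. split; [|split; trivial].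
- apply K_incl with S; trivial. intros a. apply nodup_In.
- rewrite <- H4. symmetry. now apply fsum_eq.
Qed.

Lemma rpoint_nonneg (t : A -> R) a : is_rpoint K t -> 0 <= t a.
Proof. intros [H _]. apply H. Qed.

Lemma rpoint_supported (t : A -> R) : is_rpoint K t -> exists S, K S /\ supported t S.
Proof. intros (_ & S & _ & H1 & H2 & _). eauto. Qed.

Lemma rpoint_fsum (t : A -> R) : is_rpoint K t -> fsum t = 1.
Proof. intros (_ & S & H0 & H1 & H2 & H3). rewrite <- H3. now apply fsum_eq. Qed.

Lemma rpoint_nonzero (t : A -> R) : is_rpoint K t -> exists a, 0 < t a.
Proof.
intros (H & S & H0 & H1 & H2 & H3). apply NNPP. intros Hn.
enough (lsum t S = 0) by lra. apply lsum_zero. intros a _. apply Rle_antisym; [|apply H].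
apply Rnot_lt_le. eauto.
Qed.

Lemma rpoint_simplex (t : A -> R) L : is_rpoint K t -> (forall a, In a L -> t a <> 0) -> K L.
Proof.
intros Ht HL. destruct (rpoint_supported Ht) as (S & H1 & H2). apply K_incl with S; trivial.
intros a Ha. apply H2, HL, Ha.
Qed.

Lemma rpoint_fmax (t : A -> R) : is_rpoint K t -> 0 < fmax t /\ (exists a, t a = fmax t) /\ forall a, t a <= fmax t.
Proof.
intros Ht. destruct (rpoint_supported Ht) as (S & _ & HS). destruct (rpoint_nonzero Ht) as [a Ha].
destruct (fmax_attained a HS Ha) as [H1 H2]. repeat split; trivial. intros b. now apply fmax_ge with S.
Qed.

End Realization.

(** Truncation makes all vertices with at least half the maximal coordinate tie at the top, so that
    [flow_top] places the result in all of their sets at once. The support is unchanged because the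
    maximum is positive. *)
Definition halved (A : Type) (t : A -> R) (a : A) : R := Rmin (t a) (fmax t / 2).

Lemma halved_spec A K (t : A -> R) : is_rpoint K t ->
  (forall a, 0 <= halved t a) /\ (forall a, halved t a <> 0 <-> t a <> 0).
Proof.
intros Ht. destruct (rpoint_fmax Ht) as (H1 & _ & H2). unfold halved. split; intros a;
assert (H3 := rpoint_nonneg a Ht); unfold Rmin; destruct Rle_dec; try lra; split; intros H E; try exact (H E); lra.
Qed.

Lemma fconv_halved A Z (F : (Z -> Prop) -> Prop) (FF : Filter F) (t : Z -> A -> R) t0 K :
  (forall z, is_rpoint K (t z)) -> is_rpoint K t0 ->
  fconv F t t0 -> fconv F (fun z => halved (t z)) (halved t0).
Proof.
intros Ht Ht0 H. assert (Hm := rlim_fmax FF H). destruct H as (H1 & S & H2 & H3). split.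
- intros a. apply rlim_min; trivial. apply rlim_div; [trivial|lra|trivial|]. now apply rlim_const.
- exists S. split.
  + intros a Ha. now apply H2, (halved_spec Ht0).
  + revert H3. apply filter_imp. intros z Hz a Ha. now apply Hz, (halved_spec (Ht z)).
Qed.

Lemma fconv_scal A Z (F : (Z -> Prop) -> Prop) (FF : Filter F) (t : Z -> A -> R) t0 (c : Z -> R) c0 :
  rlim F c c0 -> fconv F t t0 -> fconv F (fun z a => c z * t z a) (fun a => c0 * t0 a).
Proof.
intros Hc (H1 & S & H2 & H3). split.
- intros a. now apply rlim_mult.
- exists S. split.
  + intros a Ha. apply H2. intros E. apply Ha. rewrite E. ring.
  + revert H3. apply filter_imp. intros z Hz a Ha. apply Hz. intros E. apply Ha. rewrite E. ring.
Qed.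

(* The map [g] is obtained by contracting along the superlevel sets of a point of the realization; [G] is the same construction with a free starting point. *)
Lemma carried_map A Y (cY : convergence Y) (W : A -> Y -> Prop) (K : list A -> Prop) :
  (forall s s', incl s' s -> K s -> K s') ->
  (forall L, L <> nil -> K L -> exists c, contracts cY (meet W L) c) ->
  exists (g : pt (realization K) -> Y) (G : Y -> pt (realization K) -> R -> Y),
    (forall Z (F : (Z -> Prop) -> Prop), Filter F -> forall t t0,
       conv (conv_realization K) F t t0 -> conv cY F (fun z => g (t z)) (g t0)) /\
    (forall t a, fmax (proj1_sig t) / 2 <= proj1_sig t a -> W a (g t)) /\
    (forall y t, G y t 0 = y) /\
    (forall y t, (forall a, proj1_sig t a <> 0 -> W a y) -> G y t 1 = g t) /\
    (forall Z (F : (Z -> Prop) -> Prop), Filter F -> forall y y0 t t0 s s0,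
       conv cY F y y0 -> conv (conv_realization K) F t t0 ->
       F (fun z => 0 <= s z <= 1) -> 0 <= s0 <= 1 -> rlim F s s0 ->
       F (fun z => forall a, proj1_sig (t z) a <> 0 -> W a (y z)) ->
       (forall a, proj1_sig t0 a <> 0 -> W a y0) ->
       (forall a, ~ W a y0 -> F (fun z => proj1_sig (t z) a = 0)) ->
       conv cY F (fun z => G (y z) (t z) (s z)) (G y0 t0 s0)).
Proof.
intros K_incl K_contr.
(* The starting points are chosen without any continuity; with baseline 0 the drift does not see
   which one is taken. *)
assert (Hstart : forall t : pt (realization K), exists y, forall a, proj1_sig t a <> 0 -> W a y).
{ intros [t Ht]. simpl. destruct (rpoint_supported Ht) as (S & HS1 & HS2).
  destruct (sorted_support_spec (fun a => rpoint_nonneg a Ht) HS2) as (_ & _ & H).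
  destruct (rpoint_nonzero Ht) as [a Ha].
  destruct (K_contr (sorted_support t)) as [c Hc].
  - intros E. enough (In a nil) by trivial. rewrite <- E. apply H. lra.
  - apply rpoint_simplex with t; trivial. intros b. apply H.
  - destruct (contracts_1 Hc) as (q & Hq & _). exists q. intros b Hb. now apply Hq, H. }
destruct (choice _ Hstart) as [start Hs].
exists (fun t => drift cY W (halved (proj1_sig t)) 0 (start t)).
(* At [s = 0] all coordinates vanish, the list is empty and [y] stays put. At [s = 1] the baseline
   is 0 and the start is forgotten, which gives [g t]. *)
exists (fun y t s => drift cY W (fun a => s * halved (proj1_sig t) a) (1 - s) y).
split; [|split; [|split; [|split]]].
- intros Z F FF t t0 H.
  apply (@drift_conv A Y cY W K K_incl K_contr Z F FF (fun z => halved (proj1_sig (t z)))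
    (halved (proj1_sig t0)) (fun _ => 0) 0 (fun z => start (t z)) (start t0)).
  + apply filter_true'; trivial. intros z. apply (halved_spec (proj2_sig (t z))).
  + apply (halved_spec (proj2_sig t0)).
  + apply fconv_halved with K; trivial; intros; apply proj2_sig.
  + apply filter_true'; trivial. intros; lra.
  + lra.
  + now apply rlim_const.
  + apply filter_true'; trivial. intros z L HL. apply (rpoint_simplex K_incl L (proj2_sig (t z))).
    intros a Ha. now apply (halved_spec (proj2_sig (t z))), HL.
  + intros L HL. apply (rpoint_simplex K_incl L (proj2_sig t0)).
    intros a Ha. now apply (halved_spec (proj2_sig t0)), HL.
  + apply filter_true'; trivial. intros z a Ha. now apply Hs, (halved_spec (proj2_sig (t z))).
  + intros a Ha. now apply Hs, (halved_spec (proj2_sig t0)).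
  + left. split; trivial. destruct (rpoint_nonzero (proj2_sig t0)) as [a Ha]. exists a.
    apply (halved_spec (proj2_sig t0)). lra.
- intros [t Ht] a Ha. simpl in *. destruct (rpoint_supported Ht) as (S & HS1 & HS2).
  destruct (halved_spec Ht) as [H1 H2]. destruct (rpoint_fmax Ht) as (H3 & _ & H4).
  assert (HS3 : supported (halved t) S) by (intros b Hb; now apply HS2, H2).
  destruct (sorted_support_spec H1 HS3) as (_ & H5 & H6).
  assert (Hha : halved t a = fmax t / 2) by now apply Rmin_right.
  unfold drift. apply (@flow_top A Y cY W K K_incl K_contr); trivial.
  + apply rpoint_simplex with t; trivial. intros b Hb. now apply H2, H6.
  + intros b Hb. now apply (Hs (exist _ t Ht)), H2, H6.
  + lra.
  + apply (ascending_shift (halved t) 0) in H5. now rewrite Rplus_0_r in H5.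
  + apply H6. lra.
  + intros b _. rewrite Hha. unfold halved. pose proof (Rmin_r (t b) (fmax t / 2)). lra.
- intros y [t Ht]. simpl. unfold drift.
  assert (H : (fun a => 0 * halved t a) = (fun _ => 0)) by (apply functional_extensionality; intros; ring).
  rewrite H. destruct (sorted_support_spec (t := fun _ : A => 0) (S := nil)) as (_ & _ & H1).
  + intros; lra.
  + intros a Ha. lra.
  + destruct (sorted_support (fun _ : A => 0)) as [|a L]; trivial.
    destruct (proj1 (H1 a) (or_introl eq_refl)). trivial.
- intros y [t Ht] Hy. simpl in *.
  replace (fun a => 1 * halved t a) with (halved t) by (apply functional_extensionality; intros; ring).
  replace (1 - 1) with 0 by ring.
  destruct (rpoint_supported Ht) as (S & HS1 & HS2). destruct (halved_spec Ht) as [H1 H2].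
  apply (@drift_reset A Y cY W K K_incl K_contr) with S; trivial.
  + intros b Hb. now apply HS2, H2.
  + destruct (rpoint_nonzero Ht) as [a Ha]. exists a. apply H2. lra.
  + intros L HL. apply rpoint_simplex with t; trivial. intros a Ha. now apply H2, HL.
  + intros a Ha. now apply Hy, H2.
  + intros a Ha. now apply (Hs (exist _ t Ht)), H2.
- intros Z F FF y y0 t t0 s s0 Hy Ht Hs1 Hs0 Hsl H1 H2 H3.
  assert (Hprod : forall c x : R, c * x <> 0 -> x <> 0) by (intros c x H ->; apply H; ring).
  apply (@drift_conv A Y cY W K K_incl K_contr Z F FF
    (fun z a => s z * halved (proj1_sig (t z)) a) (fun a => s0 * halved (proj1_sig t0) a)
    (fun z => 1 - s z)).
  + revert Hs1. apply filter_imp. intros z Hz a. apply Rmult_le_pos; [lra|].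
    apply (halved_spec (proj2_sig (t z))).
  + intros a. apply Rmult_le_pos; [lra|]. apply (halved_spec (proj2_sig t0)).
  + apply fconv_scal; trivial. apply fconv_halved with K; trivial; intros; apply proj2_sig.
  + revert Hs1. apply filter_imp. intros; lra.
  + lra.
  + apply rlim_minus; trivial. now apply rlim_const.
  + apply filter_true'; trivial. intros z L HL. apply (rpoint_simplex K_incl L (proj2_sig (t z))).
    intros a Ha. apply (halved_spec (proj2_sig (t z))). now apply (Hprod (s z)), HL.
  + intros L HL. apply (rpoint_simplex K_incl L (proj2_sig t0)).
    intros a Ha. apply (halved_spec (proj2_sig t0)). now apply (Hprod s0), HL.
  + revert H1. apply filter_imp. intros z Hz a Ha. apply Hz, (halved_spec (proj2_sig (t z))).
    now apply (Hprod (s z)).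
  + intros a Ha. apply H2, (halved_spec (proj2_sig t0)). now apply (Hprod s0).
  (* The two alternatives of [drift_conv]: at [s0 = 1] the baseline vanishes and some limit
     coordinate is nonzero; for smaller [s0] the baseline is positive and convergence of [y] is
     used. *)
  + destruct (Req_dec s0 1) as [->|E].
    * left. split; [lra|]. destruct (rpoint_nonzero (proj2_sig t0)) as [a Ha]. exists a.
      rewrite Rmult_1_l. apply (halved_spec (proj2_sig t0)). lra.
    * right. split; [lra|]. split; trivial. intros a Ha. generalize (H3 a Ha). apply filter_imp.
      intros z Hz. destruct (halved_spec (proj2_sig (t z))) as [_ H].
      destruct (Req_dec (halved (proj1_sig (t z)) a) 0) as [->|E']; [ring|]. now apply H in E'.
Qed.

(** * Homotopies for convergence structures *)

Definition conv_continuous (X Y : Type) (cX : convergence X) (cY : convergence Y) (f : X -> Y) : Prop :=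
  forall Z (F : (Z -> Prop) -> Prop), Filter F -> forall x x0,
    conv cX F x x0 -> conv cY F (fun z => f (x z)) (f x0).

Definition conv_homotopic (X Y : Type) (cX : convergence X) (cY : convergence Y) (f g : X -> Y) : Prop :=
  exists H : X -> R -> Y,
    (forall Z (F : (Z -> Prop) -> Prop), Filter F -> forall x x0 s s0,
       conv cX F x x0 -> F (fun z => 0 <= s z <= 1) -> 0 <= s0 <= 1 -> rlim F s s0 ->
       conv cY F (fun z => H (x z) (s z)) (H x0 s0)) /\
    (forall x, H x 0 = f x) /\ (forall x, H x 1 = g x).

Lemma conv_homotopic_trans X Y (cX : convergence X) (cY : convergence Y) f g h :
  conv_homotopic cX cY f g -> conv_homotopic cX cY g h -> conv_homotopic cX cY f h.
Proof.
intros (H1 & Hc1 & H10 & H11) (H2 & Hc2 & H20 & H21).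
set (H := fun x s => if Rle_dec s (1 / 2) then H1 x (2 * s) else H2 x (2 * s - 1)).
assert (HH1 : forall x s, s <= 1 / 2 -> H x s = H1 x (2 * s)).
{ intros x s Hs. unfold H. destruct Rle_dec; tauto. }
assert (HH2 : forall x s, 1 / 2 <= s -> H x s = H2 x (2 * s - 1)).
{ intros x s Hs. unfold H. destruct Rle_dec as [E|E]; trivial.
  replace s with (1 / 2) by lra. replace (2 * (1 / 2)) with 1 by lra.
  replace (1 - 1) with 0 by lra. now rewrite H11, H20. }
exists H. split; [|split].
- intros Z F FF x x0 s s0 Hx Hs Hs0 Hl.
  assert (H2s : forall F' : (Z -> Prop) -> Prop, Filter F' -> rlim F' s s0 -> rlim F' (fun z => 2 * s z) (2 * s0)).
  { intros F' FF' Hl'. apply (rlim_mult FF' (f := fun _ => 2)); trivial. now apply rlim_const. }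
  apply (@conv_paste _ cY Z F (fun z => s z <= 1 / 2) (fun z => 1 / 2 <= s z)); trivial.
  + apply filter_true'; trivial. intros z. lra.
  + set (C := fun z => _). assert (FF' := within_filter _ C F FF).
    assert (HC : within C F C) by (apply (@filter_true' Z F FF (fun z => C z -> C z)); auto).
    assert (HF := fun P => @within_weaken Z F FF C P).
    destruct (Rle_lt_dec s0 (1 / 2)) as [E|E].
    * rewrite HH1 by trivial.
      apply (@conv_ext _ cY Z _ (fun z => H1 (x z) (2 * s z))); trivial.
      { revert HC. apply filter_imp. intros z Hz. symmetry. now apply HH1. }
      apply Hc1; trivial.
      -- now apply conv_mono with F.
      -- generalize (filter_and _ _ HC (HF _ Hs)). apply filter_imp. unfold C. intros; lra.
      -- lra.
      -- apply H2s; trivial. now apply rlim_mono with (1 := HF).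
    (* Here [s z] is eventually beyond 1/2, so the piece of the first half is improper. *)
    * apply conv_improper; trivial.
      generalize (filter_and _ _ HC (HF _ (rlim_lt FF (@rlim_const Z F FF (1 / 2)) Hl E))).
      apply filter_imp. unfold C. intros; lra.
  + set (C := fun z => _). assert (FF' := within_filter _ C F FF).
    assert (HC : within C F C) by (apply (@filter_true' Z F FF (fun z => C z -> C z)); auto).
    assert (HF := fun P => @within_weaken Z F FF C P).
    destruct (Rle_lt_dec (1 / 2) s0) as [E|E].
    * rewrite HH2 by trivial.
      apply (@conv_ext _ cY Z _ (fun z => H2 (x z) (2 * s z - 1))); trivial.
      { revert HC. apply filter_imp. intros z Hz. symmetry. now apply HH2. }
      apply Hc2; trivial.
      -- now apply conv_mono with F.
      -- generalize (filter_and _ _ HC (HF _ Hs)). apply filter_imp. unfold C. intros; lra.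
      -- lra.
      -- apply rlim_minus; trivial; [|now apply rlim_const].
         apply H2s; trivial. now apply rlim_mono with (1 := HF).
    * apply conv_improper; trivial.
      generalize (filter_and _ _ HC (HF _ (rlim_lt FF Hl (@rlim_const Z F FF (1 / 2)) E))).
      apply filter_imp. unfold C. intros; lra.
- intros x. rewrite HH1 by lra. now rewrite Rmult_0_r.
- intros x. rewrite HH2 by lra. now replace (2 * 1 - 1) with 1 by lra.
Qed.

Lemma conv_homotopic_comp X X' Y Y' (cX : convergence X) (cX' : convergence X')
    (cY : convergence Y) (cY' : convergence Y') f g (k : Y -> Y') (l : X' -> X) :
  conv_continuous cX' cX l -> conv_continuous cY cY' k -> conv_homotopic cX cY f g ->
  conv_homotopic cX' cY' (fun x => k (f (l x))) (fun x => k (g (l x))).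
Proof.
intros Hl Hk (H & Hc & H0 & H1). exists (fun x s => k (H (l x) s)). split; [|split].
- intros Z F FF x x0 s s0 Hx Hs Hs0 Hls. apply Hk; trivial. apply Hc; trivial. now apply Hl.
- intros x. now rewrite H0.
- intros x. now rewrite H1.
Qed.

(** * Linear homotopies in a realization *)

Lemma rlim_inv Z (F : (Z -> Prop) -> Prop) (FF : Filter F) (f : Z -> R) (l : R) :
  l <> 0 -> rlim F f l -> rlim F (fun z => / f z) (/ l).
Proof.
intros H Hf. apply (@rlim_ext _ F FF (fun z => 1 / f z)).
{ apply filter_true'; trivial. intros z. unfold Rdiv. apply Rmult_1_l. }
replace (/ l) with (1 / l) by (unfold Rdiv; apply Rmult_1_l).
apply rlim_div; trivial. now apply rlim_const.
Qed.

Lemma fconv_plus A Z (F : (Z -> Prop) -> Prop) (FF : Filter F) (t u : Z -> A -> R) t0 u0 :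
  fconv F t t0 -> fconv F u u0 -> fconv F (fun z a => t z a + u z a) (fun a => t0 a + u0 a).
Proof.
intros (H1 & S & H2 & H3) (H1' & S' & H2' & H3'). split.
- intros a. now apply rlim_plus.
- assert (HS : forall h k : A -> R, supported h S -> supported k S' -> supported (fun a => h a + k a) (S ++ S')).
  { intros h k Hh Hk a Ha. apply in_or_app. destruct (Req_dec (h a) 0) as [E|E].
    - right. apply Hk. lra.
    - left. now apply Hh. }
  exists (S ++ S'). split; auto.
  generalize (filter_and _ _ H3 H3'). apply filter_imp. intros z []. auto.
Qed.

Lemma rpoint_support A K (t : A -> R) : is_rpoint K t ->
  exists S, NoDup S /\ forall a, In a S <-> t a <> 0.
Proof.
intros Ht. destruct (rpoint_supported Ht) as (S & _ & HS).
destruct (ascending_exists (fun a => rpoint_nonneg a Ht) HS) as (L & H1 & _ & H2). eauto.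
Qed.

Lemma normalize_rpoint A (K : list A -> Prop) (k : A -> R) S :
  (forall s s', incl s' s -> K s -> K s') ->
  (forall a, 0 <= k a) -> supported k S -> K S -> (exists a, 0 < k a) ->
  0 < fsum k /\ is_rpoint K (fun a => / fsum k * k a).
Proof.
intros K_incl Hk HS HKS [a Ha]. set (S' := nodup (@eq_dec_classical A) S).
assert (HN : NoDup S') by apply NoDup_nodup. assert (HS' := supported_nodup HS : supported k S').
assert (Hpos : 0 < fsum k).
{ rewrite (fsum_eq HN HS'). apply Rlt_le_trans with (k a); trivial. apply lsum_ge; trivial.
  apply HS'. lra. }
split; trivial. apply rpoint_intro with S'; trivial.
- intros b. apply Rmult_le_pos; trivial. left. now apply Rinv_0_lt_compat.
- apply K_incl with S; trivial. intros b. apply nodup_In.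
- intros b Hb. apply HS'. intros E. apply Hb. rewrite E. ring.
- rewrite (@fsum_eq _ _ S') by (trivial; intros b Hb; apply HS'; intros E; apply Hb; rewrite E; ring).
  rewrite lsum_scal, <- (fsum_eq HN HS'). field. lra.
Qed.

(* First shrink [t] to its coordinates above [fmax t / 2], then move linearly to [u t]. *)
Lemma homotopic_id_of_common_simplex A (K : list A -> Prop) (u : pt (realization K) -> pt (realization K)) :
  (forall s s', incl s' s -> K s -> K s') ->
  conv_continuous (conv_realization K) (conv_realization K) u ->
  (forall t L, (forall a, In a L -> fmax (proj1_sig t) / 2 < proj1_sig t a \/ proj1_sig (u t) a <> 0) -> K L) ->
  conv_homotopic (conv_realization K) (conv_realization K) u (fun t => t).
Proof.
intros K_incl Hu HK.
(* Unnormalized path, from [u t] at [s = 0] to [t] at [s = 1]. The first summand cuts [t] off at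
   [(1 - s)] times its maximum; the weight of [u t] vanishes from [s = 1/2] on, exactly when the cut
   falls to half the maximum. *)
set (N := fun (t : pt (realization K)) (s : R) (a : A) =>
  Rmax 0 (proj1_sig t a - (1 - s) * fmax (proj1_sig t)) + Rmax 0 (1 - 2 * s) * proj1_sig (u t) a).
assert (HN : forall t s, 0 <= s <= 1 ->
  0 < fsum (N t s) /\ is_rpoint K (fun a => / fsum (N t s) * N t s a)).
{ intros t s Hs. destruct (rpoint_fmax (proj2_sig t)) as (Hm & [a0 Ha0] & Hle).
  set (m := fmax (proj1_sig t)) in *.
  assert (Hsm : 0 <= (1 - s) * m) by (apply Rmult_le_pos; lra).
  assert (Hpos : forall a, 0 <= Rmax 0 (1 - 2 * s) * proj1_sig (u t) a).
  { intros a. apply Rmult_le_pos; [apply Rmax_l|]. apply (rpoint_nonneg a (proj2_sig (u t))). }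
  destruct (rpoint_support (proj2_sig t)) as (S1 & _ & HS1).
  destruct (rpoint_support (proj2_sig (u t))) as (S2 & _ & HS2).
  (* The list is filtered down to the exact support of [N t s], since only this support, and not the
     union of the two supports, is known to be a simplex. *)
  set (keep := fun a => if excluded_middle_informative (N t s a <> 0) then true else false).
  apply normalize_rpoint with (filter keep (S1 ++ S2)); trivial.
  - intros a. apply Rplus_le_le_0_compat; [apply Rmax_l|trivial].
  - intros a Ha. apply filter_In. split; [|unfold keep; now destruct excluded_middle_informative].
    apply in_or_app. rewrite HS1, HS2. apply NNPP. intros Hn. apply Ha.
    assert (E1 : proj1_sig t a = 0) by tauto. assert (E2 : proj1_sig (u t) a = 0) by tauto.
    unfold N. rewrite E1, E2, Rmax_left; fold m; lra.
  - assert (Hkeep : forall a, In a (filter keep (S1 ++ S2)) -> N t s a <> 0).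
    { intros a Ha. apply filter_In in Ha. unfold keep in Ha. destruct Ha as [_ Ha].
      destruct excluded_middle_informative; [trivial|discriminate]. }
    (* Before 1/2 the cut exceeds half the maximum, so every vertex is covered by the hypothesis on
       [t] and [u t]. From 1/2 on, only vertices of [t] remain. *)
    destruct (Rlt_le_dec s (1 / 2)) as [E|E].
    + apply (HK t). intros a Ha. specialize (Hkeep a Ha). apply NNPP. intros Hn. apply Hkeep.
      fold m in Hn. assert (E2 : proj1_sig (u t) a = 0) by tauto.
      unfold N. fold m. rewrite E2, Rmax_left; [lra|].
      assert (m / 2 <= (1 - s) * m).
      { unfold Rdiv. rewrite Rmult_comm. apply Rmult_le_compat_r; lra. }
      lra.
    + apply (rpoint_simplex K_incl _ (proj2_sig t)). intros a Ha Hn.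
      specialize (Hkeep a Ha). apply Hkeep. unfold N. fold m.
      rewrite Hn, !Rmax_left; lra.
  (* A positive coordinate: at [s = 0] one of [u t]; for [s > 0] the maximizing vertex [a0], which
     contributes at least [s * m]. *)
  - destruct (Req_dec s 0) as [->|E].
    + destruct (rpoint_nonzero (proj2_sig (u t))) as [a Ha]. exists a.
      unfold N. rewrite (Rmax_right 0 (1 - 2 * 0)) by lra.
      pose proof (Rmax_l 0 (proj1_sig t a - (1 - 0) * fmax (proj1_sig t))). lra.
    + exists a0. apply Rplus_lt_le_0_compat; [|apply Hpos]. fold m. rewrite Ha0.
      apply Rlt_le_trans with (m - (1 - s) * m); [|apply Rmax_r].
      replace (m - (1 - s) * m) with (s * m) by ring. apply Rmult_lt_0_compat; lra. }
(* The fallback [t] serves only times outside the unit interval. *)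
set (H := fun t s => match excluded_middle_informative (is_rpoint K (fun a => / fsum (N t s) * N t s a)) with
  | left E => exist _ _ E : pt (realization K) | right _ => t end).
assert (HH : forall t s, 0 <= s <= 1 -> proj1_sig (H t s) = fun a => / fsum (N t s) * N t s a).
{ intros t s Hs. unfold H. destruct excluded_middle_informative as [|E]; trivial.
  elim E. now apply HN. }
assert (Hend : forall t t' s, 0 <= s <= 1 -> N t s = proj1_sig t' -> H t s = t').
{ intros t t' s Hs E. apply eq_sig_hprop; [intros; apply proof_irrelevance|].
  rewrite (HH t s Hs), E, (rpoint_fsum (proj2_sig t')).
  apply functional_extensionality. intros a. rewrite Rinv_1. ring. }
exists H. split; [|split].
- intros Z F FF t t0 s s0 Ht Hs Hs0 Hl. simpl. rewrite (HH t0 s0 Hs0).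
  apply (@fconv_ext A Z F FF (fun z a => / fsum (N (t z) (s z)) * N (t z) (s z) a)).
  { revert Hs. apply filter_imp. intros z Hz. symmetry. now apply HH. }
  assert (HNc : fconv F (fun z => N (t z) (s z)) (N t0 s0)).
  { apply fconv_plus; trivial.
    - assert (Hm := rlim_fmax FF Ht). simpl in Ht. destruct Ht as (H1 & S & H2 & H3). split.
      + intros a. apply rlim_max; trivial; [now apply rlim_const|]. apply rlim_minus; trivial.
        apply rlim_mult; trivial. apply rlim_minus; trivial. now apply rlim_const.
      + assert (HS : forall (t : pt (realization K)) s, 0 <= s <= 1 -> supported (proj1_sig t) S ->
          supported (fun a => Rmax 0 (proj1_sig t a - (1 - s) * fmax (proj1_sig t))) S).
        { intros t' s' Hs' HS a Ha. apply HS. intros E. apply Ha. rewrite E.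
          destruct (rpoint_fmax (proj2_sig t')) as (Hm' & _).
          apply Rmax_left. pose proof (Rmult_le_pos (1 - s') (fmax (proj1_sig t')) ltac:(lra) ltac:(lra)). lra. }
        exists S. split; auto. generalize (filter_and _ _ Hs H3). apply filter_imp. intros z []. auto.
    - apply fconv_scal; [trivial| |now apply Hu].
      apply rlim_max; trivial; [now apply rlim_const|]. apply rlim_minus; [trivial|now apply rlim_const|].
      apply (rlim_mult FF (f := fun _ => 2)); trivial. now apply rlim_const. }
  apply fconv_scal; trivial. apply rlim_inv; trivial; [|now apply rlim_fsum].
  destruct (HN t0 s0 Hs0). lra.
- intros t. apply Hend; [lra|]. apply functional_extensionality. intros a. unfold N.
  destruct (rpoint_fmax (proj2_sig t)) as (Hm & _ & Hle). specialize (Hle a).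
  rewrite Rmax_left, Rmax_right; lra.
- intros t. apply Hend; [lra|]. apply functional_extensionality. intros a. unfold N.
  pose proof (rpoint_nonneg a (proj2_sig t)). rewrite Rmax_right, Rmax_left; lra.
Qed.

(** * Dowker duality *)

(** Both Dowker complexes have this form, one for the relation and one for its converse. For a cover
    [U], [common U] is the nerve, and the converse relation gives [in_some_member U]. *)
Definition common (A B : Type) (R : A -> B -> Prop) (s : list A) : Prop :=
  exists b, forall a, In a s -> R a b.

Lemma common_incl A B (R : A -> B -> Prop) s s' : incl s' s -> common R s -> common R s'.
Proof. intros H [b Hb]. exists b. auto. Qed.

(** The straight segment from [y] to the vertex [b]. The fallback [y] only makes the function
    total. *)
Definition toward_vertex (B : Type) (K : list B -> Prop) (b : B) (y : pt (realization K)) (s : R) :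
    pt (realization K) :=
  match excluded_middle_informative (is_rpoint K
    (fun x => (1 - s) * proj1_sig y x + s * (if excluded_middle_informative (x = b) then 1 else 0))) with
  | left E => exist _ _ E
  | right _ => y
  end.

Arguments toward_vertex [B] K b y s.

Lemma toward_vertex_eq B (K : list B -> Prop) (b : B) (y : pt (realization K)) (s : R) :
  (forall s s', incl s' s -> K s -> K s') ->
  (forall L, (forall x, In x L -> x = b \/ proj1_sig y x <> 0) -> K L) -> 0 <= s <= 1 ->
  proj1_sig (toward_vertex K b y s) =
  fun x => (1 - s) * proj1_sig y x + s * (if excluded_middle_informative (x = b) then 1 else 0).
Proof.
intros K_incl HK Hs. unfold toward_vertex.
destruct excluded_middle_informative as [|E]; trivial. elim E. clear E.
destruct (rpoint_support (proj2_sig y)) as (S & _ & HS).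
set (S' := nodup (@eq_dec_classical B) (b :: S)).
assert (HN : NoDup S') by apply NoDup_nodup.
assert (HS' : supported (proj1_sig y) S').
{ intros x Hx. apply nodup_In. right. now apply HS. }
assert (Hb : supported (fun x => if excluded_middle_informative (x = b) then 1 else 0) (b :: nil)).
{ intros x Hx. destruct excluded_middle_informative as [->|]; [now left|lra]. }
assert (Hb' : supported (fun x => if excluded_middle_informative (x = b) then 1 else 0) S').
{ revert Hb. apply supported_incl. intros x [<-|[]]. apply nodup_In. now left. }
assert (Hsupp : supported (fun x => (1 - s) * proj1_sig y x +
  s * (if excluded_middle_informative (x = b) then 1 else 0)) S').
{ intros x Hx. destruct (Req_dec (proj1_sig y x) 0) as [E|E]; [|now apply HS'].
  apply Hb'. intros E'. apply Hx. rewrite E, E'. ring. }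
apply rpoint_intro with S'; trivial.
- intros x. pose proof (rpoint_nonneg x (proj2_sig y)). apply Rplus_le_le_0_compat; apply Rmult_le_pos; try lra.
  destruct excluded_middle_informative; lra.
- apply HK. intros x Hx. apply nodup_In in Hx. destruct Hx as [<-|Hx]; [now left|]. right. now apply HS.
- rewrite (fsum_eq HN Hsupp), lsum_plus, !lsum_scal, <- (fsum_eq HN HS'), (rpoint_fsum (proj2_sig y)).
  rewrite (@lsum_supported _ _ S' (b :: nil)); trivial.
  + unfold lsum. simpl. destruct excluded_middle_informative; [lra|congruence].
  + constructor; [intros []|constructor].
Qed.

(** [P] is a union of closed faces that can all be coned off from [b] without leaving [P], and the
    cones are simplices of [K]. *)
Lemma toward_vertex_contracts B (K : list B -> Prop) (b : B) (P : pt (realization K) -> Prop) :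
  (forall s s', incl s' s -> K s -> K s') ->
  (exists y, P y) ->
  (forall y y', P y -> (forall x, proj1_sig y' x <> 0 -> x = b \/ proj1_sig y x <> 0) -> P y') ->
  (forall y, P y -> forall L, (forall x, In x L -> x = b \/ proj1_sig y x <> 0) -> K L) ->
  contracts (conv_realization K) P (toward_vertex K b).
Proof.
intros K_incl [y1 Hy1] HP HK.
assert (Heq := fun y s Hy => @toward_vertex_eq B K b y s K_incl (HK y Hy)).
assert (Hin : forall y s, P y -> 0 <= s <= 1 -> P (toward_vertex K b y s)).
{ intros y s Hy Hs. apply HP with y; trivial. intros x. rewrite Heq by trivial. intros Hx.
  destruct excluded_middle_informative as [E|E]; [now left|]. right. intros E'. apply Hx. rewrite E'. ring. }
assert (Hsig : forall y y' : pt (realization K), proj1_sig y = proj1_sig y' -> y = y').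
{ intros y y' E. apply eq_sig_hprop; trivial. intros; apply proof_irrelevance. }
split; trivial.
- intros y Hy. apply Hsig. rewrite Heq by (trivial; lra).
  apply functional_extensionality. intros x. ring.
- exists (toward_vertex K b y1 1). split; [apply Hin; trivial; lra|].
  intros y Hy. apply Hsig. rewrite !Heq by (trivial; lra).
  apply functional_extensionality. intros x. ring.
- intros Z F FF y y0 s s0 Hy Hy0 Hc Hs Hs0 Hl. simpl. rewrite Heq by trivial.
  apply (@fconv_ext B Z F FF (fun z x => (1 - s z) * proj1_sig (y z) x +
    s z * (if excluded_middle_informative (x = b) then 1 else 0))).
  { generalize (filter_and _ _ Hy Hs). apply filter_imp. intros z []. symmetry. now apply Heq. }
  apply fconv_plus; trivial; apply fconv_scal; trivial.
  + apply rlim_minus; trivial. now apply rlim_const.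
  + split; [intros; now apply rlim_const|]. exists (b :: nil).
    assert (Hb : supported (fun x => if excluded_middle_informative (x = b) then 1 else 0) (b :: nil)).
    { intros x Hx. destruct excluded_middle_informative as [->|]; [now left|lra]. }
    split; trivial. now apply filter_true'.
Qed.

(** [carried_map] is applied to the sets of points all of whose vertices are related to [a]. Over a
    nonempty simplex [L] with witness [b] their intersection contains the vertex [b] and contracts
    to it linearly: any [a] in [L] is related to [b] and to all vertices involved, so these span
    simplices. *)
Lemma dowker_map A B (R : A -> B -> Prop) :
  exists g : pt (realization (common R)) -> pt (realization (common (fun b a => R a b))),
    conv_continuous (conv_realization (common R)) (conv_realization (common (fun b a => R a b))) g /\
    forall t a b, fmax (proj1_sig t) / 2 <= proj1_sig t a -> proj1_sig (g t) b <> 0 -> R a b.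
Proof.
set (K' := common (fun b a => R a b)).
destruct (@carried_map A _ (conv_realization K') (fun a y => forall b, proj1_sig y b <> 0 -> R a b)
  (common R)) as (g & _ & H1 & H2 & _).
- intros s s'. apply common_incl.
- intros L Hne [b Hb]. exists (toward_vertex K' b).
  (* The vertex [b] as a point, written with the factor [/ 1] to match [normalize_rpoint]. *)
  assert (HK : is_rpoint K' (fun x => / 1 * (if excluded_middle_informative (x = b) then 1 else 0))).
  { replace (/ 1) with (/ fsum (fun x => if excluded_middle_informative (x = b) then 1 else 0)).
    2:{ rewrite (@fsum_eq _ _ (b :: nil)).
      - unfold lsum. simpl. destruct excluded_middle_informative; [f_equal; lra|congruence].
      - constructor; [intros []|constructor].
      - intros x Hx. destruct excluded_middle_informative as [->|]; [now left|lra]. }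
    apply normalize_rpoint with (b :: nil).
    - intros s s'. apply common_incl.
    - intros x. destruct excluded_middle_informative; lra.
    - intros x Hx. destruct excluded_middle_informative as [->|]; [now left|lra].
    - destruct L as [|a L]; [congruence|]. exists a. intros x [<-|[]]. apply Hb. now left.
    - exists b. destruct excluded_middle_informative; [lra|congruence]. }
  apply toward_vertex_contracts.
  + intros s s'. apply common_incl.
  + exists (exist _ _ HK). intros a Ha x. simpl. destruct excluded_middle_informative as [->|]; [auto|lra].
  + intros y y' Hy Hy' a Ha x Hx. destruct (Hy' x Hx) as [->|H]; [auto|]. now apply (Hy a Ha).
  + intros y Hy L' HL'. destruct L as [|a L]; [congruence|]. exists a. intros x Hx.
    destruct (HL' x Hx) as [->|H]; [apply Hb; now left|]. apply (Hy a); [now left|trivial].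
- exists g. split; trivial. intros t a b Ha Hb. now apply (H2 t a Ha).
Qed.

(** Let [b] maximize the coordinates of [g t]. As a vertex of [g t] it is related to every [a] with
    [t a] above half the maximum; as a maximal coordinate it is related to every vertex of
    [g' (g t)]. So [b] witnesses the common simplex. *)
Lemma dowker_inverse A B (R : A -> B -> Prop)
    (g : pt (realization (common R)) -> pt (realization (common (fun b a => R a b))))
    (g' : pt (realization (common (fun b a => R a b))) -> pt (realization (common R))) :
  conv_continuous (conv_realization (common R)) (conv_realization (common (fun b a => R a b))) g ->
  conv_continuous (conv_realization (common (fun b a => R a b))) (conv_realization (common R)) g' ->
  (forall t a b, fmax (proj1_sig t) / 2 <= proj1_sig t a -> proj1_sig (g t) b <> 0 -> R a b) ->
  (forall t a b, fmax (proj1_sig t) / 2 <= proj1_sig t b -> proj1_sig (g' t) a <> 0 -> R a b) ->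
  conv_homotopic (conv_realization (common R)) (conv_realization (common R))
    (fun t => g' (g t)) (fun t => t).
Proof.
intros Hg Hg' H1 H2. apply homotopic_id_of_common_simplex.
- intros s s'. apply common_incl.
- intros Z F FF t t0 Ht. apply Hg'; trivial. now apply Hg.
- intros t L HL. destruct (rpoint_fmax (proj2_sig (g t))) as (Hm & [b Hb] & _).
  exists b. intros a Ha. destruct (HL a Ha) as [H|H].
  + apply (H1 t); lra.
  + apply (H2 (g t)); [lra|trivial].
Qed.

(** * The nerve of a good numerable cover *)

Lemma metric_self X (d : X -> X -> R) x : is_metric d -> d x x = 0.
Proof. intros (_ & H & _). now apply H. Qed.

Definition conv_metric (X : Type) (d : X -> X -> R) (Hd : is_metric d) : convergence X.
Proof.
refine (@Convergence X (fun Z F y y0 => forall eps, 0 < eps -> F (fun z => d y0 (y z) < eps)) _ _ _ _).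
- auto.
- intros Z F y y' y0 FF H H1 eps He. generalize (filter_and _ _ H (H1 eps He)). apply filter_imp.
  intros z [<- Hz]. exact Hz.
- intros Z F y0 FF eps He. apply filter_true'; trivial. intros _. now rewrite metric_self.
- intros Z F C D y y0 FF H H1 H2 eps He. unfold within in *.
  generalize (filter_and _ _ H (filter_and _ _ (H1 eps He) (H2 eps He))). apply filter_imp. tauto.
Defined.

Lemma conv_metric_open X (d : X -> X -> R) (Hd : is_metric d) Z (F : (Z -> Prop) -> Prop)
    (FF : Filter F) V (y : Z -> X) y0 :
  is_open (metric_space d) V -> V y0 -> conv (conv_metric Hd) F y y0 -> F (fun z => V (y z)).
Proof.
intros HV Hy H. destruct (HV _ Hy) as (eps & He & Hball). generalize (H eps He). apply filter_imp.
intros z. apply Hball.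
Qed.

Lemma metric_ball_open X (d : X -> X -> R) x eps : is_metric d ->
  is_open (metric_space d) (fun y => d x y < eps).
Proof.
intros (_ & _ & _ & Htri) y Hy. exists (eps - d x y). split; [lra|]. intros z Hz.
specialize (Htri x y z). lra.
Qed.

Lemma conv_metric_rlim X (d : X -> X -> R) (Hd : is_metric d) Z (F : (Z -> Prop) -> Prop)
    (FF : Filter F) (phi : X -> R) (y : Z -> X) y0 :
  continuous (metric_space d) R_space phi -> conv (conv_metric Hd) F y y0 ->
  rlim F (fun z => phi (y z)) (phi y0).
Proof.
intros Hphi Hy. apply rlim_eps; trivial. intros eps He.
assert (HV : is_open R_space (fun b => Rabs (b - phi y0) < eps)).
{ intros b Hb. exists (eps - Rabs (b - phi y0)). split; [lra|]. intros c Hc.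
  rewrite Rabs_minus_sym in Hc.
  pose proof (Rabs_triang (c - b) (b - phi y0)) as H. replace (c - b + (b - phi y0)) with (c - phi y0) in H by ring.
  lra. }
apply (@conv_metric_open X d Hd Z F FF _ y y0 (Hphi _ HV)); trivial.
now rewrite Rminus_diag, Rabs_R0.
Qed.

Lemma contractible_contracts X (d : X -> X -> R) (Hd : is_metric d) (P : X -> Prop) :
  contractible (subspace (metric_space d) P) -> exists c, contracts (conv_metric Hd) P c.
Proof.
intros (a0 & H & Hcont & H0 & H1).
(* The contraction of the subspace, extended by the identity where membership or the time bound
   fails. *)
set (c := fun y s => match excluded_middle_informative (P y), excluded_middle_informative (0 <= s <= 1) with
  | left Hy, left Hs => proj1_sig (H (exist P y Hy, exist (fun t => 0 <= t <= 1) s Hs))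
  | _, _ => y end).
assert (Hc : forall y s (Hy : P y) (Hs : 0 <= s <= 1),
  c y s = proj1_sig (H (exist P y Hy, exist (fun t => 0 <= t <= 1) s Hs))).
{ intros y s Hy Hs. unfold c. destruct excluded_middle_informative as [Hy'|]; [|tauto].
  destruct excluded_middle_informative as [Hs'|]; [|tauto].
  now rewrite (proof_irrelevance _ Hy' Hy), (proof_irrelevance _ Hs' Hs). }
exists c. split.
- intros y s Hy Hs. rewrite (Hc y s Hy Hs). apply proj2_sig.
- intros y Hy. rewrite (Hc y 0 Hy ltac:(lra)), H0; trivial.
- exists (proj1_sig a0). split; [apply proj2_sig|]. intros y Hy.
  rewrite (Hc y 1 Hy ltac:(lra)), H1; trivial.
- intros Z F FF y y0 s s0 Hy Hy0 Hyc Hs Hs0 Hsc eps He.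
  set (V := fun a : pt (subspace (metric_space d) P) => d (c y0 s0) (proj1_sig a) < eps).
  assert (HV : is_open (subspace (metric_space d) P) V).
  { exists (fun x => d (c y0 s0) x < eps). split; [now apply metric_ball_open|]. intros; tauto. }
  destruct (Hcont V HV (exist P y0 Hy0) (exist (fun t => 0 <= t <= 1) s0 Hs0))
    as (U1 & U2 & (U1' & HU1' & HU1) & Hy1 & (U2' & HU2' & HU2) & Hs1 & Hbox).
  { unfold V. rewrite <- (Hc y0 s0). now rewrite metric_self. }
  apply HU1 in Hy1. apply HU2 in Hs1. simpl in Hy1, Hs1.
  destruct (HU2' s0 Hs1) as (del & Hdel & Hball).
  rewrite rlim_eps in Hsc by trivial.
  generalize (filter_and _ _ (filter_and _ _ Hy Hs)
    (filter_and _ _ (@conv_metric_open X d Hd Z F FF _ y y0 HU1' Hy1 Hyc) (Hsc del Hdel))).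
  apply filter_imp. intros z [[Hyz Hsz] [HyU Hsd]].
  rewrite (Hc (y z) (s z) Hyz Hsz). apply Hbox.
  + now apply HU1.
  + apply HU2. simpl. apply Hball. now rewrite Rabs_minus_sym.
Qed.

(** Summation along the fibers of [idx]; it shows that a partition of unity regrouped by cover
    members still sums to 1. *)
Lemma lsum_fiber J I (idx : J -> I) (h : J -> R) S l : NoDup S -> (forall j, In j l -> In (idx j) S) ->
  lsum (fun i => lsum (fun j => if excluded_middle_informative (idx j = i) then h j else 0) l) S = lsum h l.
Proof.
intros HN. induction l as [|j l IH]; intros H.
- now apply lsum_zero.
- change (lsum (fun i => (if excluded_middle_informative (idx j = i) then h j else 0) +
    lsum (fun j => if excluded_middle_informative (idx j = i) then h j else 0) l) S = h j + lsum h l).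
  rewrite lsum_plus, IH by (intros; apply H; now right). f_equal.
  rewrite (@lsum_supported _ _ S (idx j :: nil)); trivial.
  + unfold lsum. simpl. destruct excluded_middle_informative; [lra|congruence].
  + constructor; [intros []|constructor].
  + intros i Hi. destruct excluded_middle_informative as [<-|]; [|lra]. apply H. now left.
  + intros i Hi. destruct excluded_middle_informative as [<-|]; [now left|lra].
Qed.

(** The functions are indexed by [J]; choosing for each a member containing its support and adding
    up the functions with the same member gives barycentric coordinates on the nerve. The last
    clause is local vanishing off a member, which the homotopy [G] of [carried_map] requires. *)
Lemma numerable_cover_map X (d : X -> X -> R) (Hd : is_metric d) I (U : I -> X -> Prop) :
  numerable_cover d U ->
  exists f : X -> pt (realization (common U)),
    conv_continuous (conv_metric Hd) (conv_realization (common U)) f /\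
    (forall x i, proj1_sig (f x) i <> 0 -> U i x) /\
    (forall Z (F : (Z -> Prop) -> Prop), Filter F -> forall x x0,
      conv (conv_metric Hd) F x x0 -> forall i, ~ U i x0 -> F (fun z => proj1_sig (f (x z)) i = 0)).
Proof.
intros (J & phi & Hphi & Hpos & Hloc & Hsum & Hsub).
destruct (choice _ Hsub) as [idx Hidx].
set (part := fun x i j => if excluded_middle_informative (idx j = i) then phi j x else 0).
set (f := fun x i => fsum (part x i)).
assert (Hpart : forall x l, supported (fun j => phi j x) l -> forall i, supported (part x i) l).
{ intros x l Hl i j Hj. apply Hl. unfold part in Hj. destruct excluded_middle_informative; lra. }
assert (Hf0 : forall x i, f x i <> 0 -> exists j, idx j = i /\ phi j x <> 0).
{ intros x i Hx. apply NNPP. intros Hn. apply Hx. unfold f.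
  rewrite (@fsum_eq _ _ nil); trivial; [constructor|].
  intros j Hj. apply Hn. exists j. unfold part in Hj. destruct excluded_middle_informative; [auto|lra]. }
assert (Hsupp : forall j x, phi j x <> 0 -> support d (phi j) x).
{ intros j x Hx eps He. exists x. now rewrite metric_self. }
assert (HfU : forall x i, f x i <> 0 -> U i x).
{ intros x i Hx. destruct (Hf0 x i Hx) as (j & <- & Hj). auto. }
assert (Hfs : forall x l, supported (fun j => phi j x) l -> supported (f x) (map idx l)).
{ intros x l Hl i Hi. destruct (Hf0 x i Hi) as (j & <- & Hj). apply in_map, Hl, Hj. }
assert (Hrp : forall x, is_rpoint (common U) (f x)).
{ intros x. destruct (Hsum x) as (l & HN & Hl & H1).
  assert (Hfp : forall i, 0 <= f x i).
  { intros i. unfold f. rewrite (fsum_eq HN (Hpart x l Hl i)). apply lsum_nonneg. intros j.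
    unfold part. destruct excluded_middle_informative; [apply Hpos|lra]. }
  destruct (ascending_exists Hfp (Hfs x l Hl)) as (S & HSN & _ & HS).
  apply rpoint_intro with S; trivial.
  - intros s s'. apply common_incl.
  - exists x. intros i Hi. now apply HfU, HS.
  - intros i Hi. now apply HS.
  - set (S' := nodup (@eq_dec_classical I) (map idx l)).
    rewrite (@fsum_eq _ _ S'); [|apply NoDup_nodup|now apply supported_nodup, Hfs].
    rewrite <- H1, <- (@lsum_fiber J I idx (fun j => phi j x) S' l).
    + apply lsum_ext. intros i _. unfold f. now rewrite (fsum_eq HN (Hpart x l Hl i)).
    + apply NoDup_nodup.
    + intros j Hj. now apply nodup_In, in_map. }
exists (fun x => exist _ (f x) (Hrp x)). simpl. split; [|split; trivial].
- intros Z F FF x x0 Hx. simpl. destruct (Hloc x0) as (V & HV & HV0 & l & Hl).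
  assert (HF : F (fun z => supported (fun j => phi j (x z)) l)).
  { generalize (@conv_metric_open X d Hd Z F FF V x x0 HV HV0 Hx). apply filter_imp.
    intros z Hz j Hj. apply Hl. eauto. }
  assert (H0 : supported (fun j => phi j x0) l) by (intros j Hj; apply Hl; eauto).
  split.
  + intros i. apply (rlim_fsum FF (t := fun z => part (x z) i)). split.
    * intros j. unfold part. destruct excluded_middle_informative; [|now apply rlim_const].
      now apply (conv_metric_rlim (Hd := Hd)).
    * exists l. split; auto. revert HF. apply filter_imp. auto.
  + exists (map idx l). split; auto. revert HF. apply filter_imp. auto.
- intros Z F FF x x0 Hx i Hi. destruct (Hloc x0) as (V & HV & HV0 & l & Hl).
  assert (Hz : F (fun z => forall j, In j l -> idx j = i -> phi j (x z) = 0)).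
  { apply filter_forall_in; trivial. intros j _.
    destruct (classic (idx j = i)) as [E|E]; [|apply filter_true'; tauto].
    (* Supports are closed: since [x0] is outside [U i], it is outside the support of [phi j], and a
       whole ball around [x0] avoids the nonzero set. Local finiteness leaves only finitely many
       such [j]. *)
    assert (Hns : ~ support d (phi j) x0) by (intros Hs; apply Hi; rewrite <- E; auto).
    apply not_all_ex_not in Hns. destruct Hns as [eps Heps].
    apply imply_to_and in Heps. destruct Heps as [He Hno].
    generalize (Hx eps He). apply filter_imp. intros z Hz _. apply NNPP. intros Hne.
    apply Hno. exists (x z). split; trivial. destruct Hd as (_ & _ & Hsym & _). now rewrite Hsym. }
  generalize (filter_and _ _ Hz (@conv_metric_open X d Hd Z F FF V x x0 HV HV0 Hx)). apply filter_imp.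
  intros z [H1 H2]. apply NNPP. intros Hne. destruct (Hf0 _ _ Hne) as (j & Hj & Hj').
  apply Hj'. apply H1; trivial. apply Hl. eauto.
Qed.

Lemma nerve_theorem X (d : X -> X -> R) (Hd : is_metric d) I (U : I -> X -> Prop) :
  good_cover d U -> numerable_cover d U ->
  exists (f : X -> pt (realization (common U))) (g : pt (realization (common U)) -> X),
    conv_continuous (conv_metric Hd) (conv_realization (common U)) f /\
    conv_continuous (conv_realization (common U)) (conv_metric Hd) g /\
    conv_homotopic (conv_metric Hd) (conv_metric Hd) (fun x => g (f x)) (fun x => x) /\
    conv_homotopic (conv_realization (common U)) (conv_realization (common U))
      (fun t => f (g t)) (fun t => t).
Proof.
intros Hgood Hnum. destruct (numerable_cover_map Hd Hnum) as (f & Hf & HfU & Hf0).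
destruct (@carried_map I X (conv_metric Hd) U (common U)) as (g & G & Hg & HgU & HG0 & HG1 & HG).
- intros s s'. apply common_incl.
- intros L HL [x Hx]. apply contractible_contracts.
  destruct (Hgood L HL) as [H|H]; [|exact H]. elim (H x Hx).
- exists f, g. split; [trivial|]. split; [exact Hg|]. split.
  (* Time is reversed because [G] starts at [x] and ends at [g (f x)]. *)
  + exists (fun x s => G x (f x) (1 - s)). split; [|split].
    * intros Z F FF x x0 s s0 Hx Hs Hs0 Hl. apply HG; trivial.
      -- now apply Hf.
      -- revert Hs. apply filter_imp. intros; lra.
      -- lra.
      -- apply rlim_minus; trivial. now apply rlim_const.
      -- apply filter_true'; trivial. intros z i. apply HfU.
      -- intros i. apply HfU.
      -- intros i Hi. now apply (Hf0 Z F FF x x0).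
    * intros x. replace (1 - 0) with 1 by ring. apply HG1. intros i. apply HfU.
    * intros x. replace (1 - 1) with 0 by ring. apply HG0.
  + apply homotopic_id_of_common_simplex.
    * intros s s'. apply common_incl.
    * intros Z F FF t t0 Ht. apply Hf; trivial. now apply Hg.
    (* The point [g t] lies in the members where [t] exceeds half its maximum, by the property of
       [g], and in those of the support of [f (g t)], by subordination. *)
    * intros t L HL. exists (g t). intros i Hi. destruct (HL i Hi) as [H|H].
      -- apply HgU. lra.
      -- now apply HfU.
Qed.

(** * From convergence structures to topologies *)

(** The bridge from filters to the given topologies. The third field treats the product with the
    interval, on which homotopies must be continuous; for weak topologies it takes a compactness
    argument. *)
Record tests (S : space) (cS : convergence (pt S)) : Prop := {
  tests_open : forall V, is_open S V -> forall Z (F : (Z -> Prop) -> Prop), Filter F ->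
    forall y y0, V y0 -> conv cS F y y0 -> F (fun z => V (y z));
  tests_is_open : forall V, (forall Z (F : (Z -> Prop) -> Prop), Filter F ->
    forall y y0, V y0 -> conv cS F y y0 -> F (fun z => V (y z))) -> is_open S V;
  tests_prod_I : forall W : pt (prod_I S) -> Prop,
    (forall Z (F : (Z -> Prop) -> Prop), Filter F -> forall y y0 (s : Z -> pt unit_interval) s0,
       W (y0, s0) -> conv cS F y y0 -> rlim F (fun z => proj1_sig (s z)) (proj1_sig s0) ->
       F (fun z => W (y z, s z))) -> is_open (prod_I S) W }.

Lemma continuous_of_conv S T (cS : convergence (pt S)) (cT : convergence (pt T)) f :
  tests S cS -> tests T cT -> conv_continuous cS cT f -> continuous S T f.
Proof.
intros HS HT Hf V HV. apply (tests_is_open HS). intros Z F FF y y0 Hy0 Hy.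
apply (@tests_open T cT HT V HV Z F FF (fun z => f (y z)) _ Hy0). now apply Hf.
Qed.

Lemma homotopic_of_conv S T (cS : convergence (pt S)) (cT : convergence (pt T)) f g :
  tests S cS -> tests T cT -> conv_homotopic cS cT f g -> homotopic S T f g.
Proof.
intros HS HT (H & Hc & H0 & H1). exists (fun p => H (fst p) (proj1_sig (snd p))). split; [|split].
- intros V HV. apply (tests_prod_I HS). intros Z F FF y y0 s s0 HW Hy Hs. simpl in *.
  apply (@tests_open T cT HT V HV Z F FF (fun z => H (y z) (proj1_sig (s z))) _ HW). apply Hc; trivial.
  + apply filter_true'; trivial. intros z. apply proj2_sig.
  + apply proj2_sig.
- intros a t Ht. change (H a (proj1_sig t) = f a). etransitivity; [exact (f_equal (H a) Ht)|apply H0].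
- intros a t Ht. change (H a (proj1_sig t) = g a). etransitivity; [exact (f_equal (H a) Ht)|apply H1].
Qed.

Definition balls (T : Type) (e : T -> R) (P : T -> Prop) : Prop :=
  exists eps, 0 < eps /\ forall q, e q < eps -> P q.

Lemma balls_filter T (e : T -> R) : Filter (balls e).
Proof.
split.
- exists 1. split; [lra|trivial].
- intros P Q (e1 & H1 & H1') (e2 & H2 & H2'). exists (Rmin e1 e2). split; [now apply Rmin_glb_lt|].
  intros q Hq. split; [apply H1'|apply H2']; eapply Rlt_le_trans; eauto; [apply Rmin_l|apply Rmin_r].
- intros P Q H (e1 & H1 & H1'). exists e1. auto.
Qed.

Definition interval_nbhd (s0 : R) : (pt unit_interval -> Prop) -> Prop :=
  balls (fun s => Rabs (proj1_sig s - s0)).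

Lemma interval_ball_open s0 eps :
  is_open unit_interval (fun s => Rabs (proj1_sig s - s0) < eps).
Proof.
exists (fun s => Rabs (s - s0) < eps). split; [|intros; tauto].
intros b Hb. exists (eps - Rabs (b - s0)). split; [lra|]. intros c Hc.
rewrite Rabs_minus_sym in Hc.
pose proof (Rabs_triang (c - b) (b - s0)) as H. replace (c - b + (b - s0)) with (c - s0) in H by ring.
lra.
Qed.

Lemma rlim_prod_interval T (F : (T -> Prop) -> Prop) (FF : Filter F) s0 :
  rlim (filter_prod F (interval_nbhd s0)) (fun q => proj1_sig (snd q)) s0.
Proof.
assert (FI := balls_filter (fun s : pt unit_interval => Rabs (proj1_sig s - s0))).
apply rlim_eps; [apply filter_prod_filter; trivial|].
intros eps He. apply Filter_prod with (Q := fun _ => True) (R := fun s => Rabs (proj1_sig s - s0) < eps); trivial.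
- apply Hierarchy.filter_true.
- exists eps. auto.
Qed.

Lemma tests_metric X (d : X -> X -> R) (Hd : is_metric d) : tests (metric_space d) (conv_metric Hd).
Proof.
split.
- intros V HV Z F FF y y0. now apply conv_metric_open.
- intros V H x Hx. assert (FB := balls_filter (fun y => d x y)).
  destruct (H X (balls (fun y => d x y)) FB (fun y => y) x Hx) as (eps & He & Hball); [|eauto].
  intros eps He. exists eps. auto.
- intros W H x s HW.
  assert (FB := balls_filter (fun y => d x y)).
  assert (FI := balls_filter (fun s' : pt unit_interval => Rabs (proj1_sig s' - proj1_sig s))).
  destruct (H _ (filter_prod (balls (fun y => d x y)) (interval_nbhd (proj1_sig s)))
    (filter_prod_filter _ _ _ _ FB FI) fst x snd s HW) as [Q R0 (e1 & H1 & H1') (e2 & H2 & H2') HQR].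
  + intros eps He. apply Filter_prod with (Q := fun y => d x y < eps) (R := fun _ => True); trivial.
    * exists eps. auto.
    * apply Hierarchy.filter_true.
  + now apply rlim_prod_interval.
  + exists (fun y => d x y < e1), (fun s' => Rabs (proj1_sig s' - proj1_sig s) < e2).
    split; [now apply metric_ball_open|]. split; [now rewrite metric_self|].
    split; [apply interval_ball_open|]. split; [now rewrite Rminus_diag, Rabs_R0|].
    intros y s' Hy Hs. apply (HQR y s'); auto.
Qed.

(** Compactness of the interval in filter form, proved by taking the supremum of the right ends up
    to which the property holds eventually. *)
Lemma compact_filter Z (F : (Z -> Prop) -> Prop) (FF : Filter F) (C : Z -> R -> Prop) lo hi :
  (forall t, lo <= t <= hi -> exists del, 0 < del /\
     F (fun z => forall t', lo <= t' <= hi -> Rabs (t' - t) < del -> C z t')) ->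
  F (fun z => forall t, lo <= t <= hi -> C z t).
Proof.
intros H. destruct (Rlt_le_dec hi lo) as [E|E].
{ apply filter_true'; trivial. intros; lra. }
set (good := fun u => lo <= u <= hi /\ F (fun z => forall t, lo <= t <= u -> C z t)).
assert (Hlo : good lo).
{ split; [lra|]. destruct (H lo ltac:(lra)) as (del & Hdel & HF). revert HF. apply filter_imp.
  intros z Hz t Ht. apply Hz; [lra|]. replace (t - lo) with 0 by lra. now rewrite Rabs_R0. }
destruct (completeness good) as [m [Hub Hlub]].
{ exists hi. intros u [Hu _]. lra. }
{ exists lo. exact Hlo. }
assert (Hm : lo <= m <= hi).
{ split; [now apply Hub|]. apply Hlub. intros u [Hu _]. lra. }
destruct (H m Hm) as (del & Hdel & HF).
assert (Hex : exists u, good u /\ m - del < u).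
{ apply NNPP. intros Hn. assert (m <= m - del); [|lra]. apply Hlub. intros u Hu.
  apply Rnot_lt_le. intros Hlt. apply Hn. eauto. }
destruct Hex as (u & [Hu HFu] & Hmu).
(* The property extends past the supremum [m] by [del / 2] unless [hi] comes first; since [v <= m],
   it follows that [v = hi]. *)
set (v := Rmin hi (m + del / 2)).
assert (Hv : good v).
{ split; [split; [apply Rmin_glb; lra|apply Rmin_l]|].
  generalize (filter_and _ _ HF HFu). apply filter_imp. intros z [H1 H2] t Ht.
  assert (Ht' : t <= hi /\ t <= m + del / 2).
  { split; eapply Rle_trans; try apply Ht; [apply Rmin_l|apply Rmin_r]. }
  destruct (Rle_lt_dec t u) as [Htu|Htu]; [apply H2; lra|]. apply H1; [lra|].
  apply Rabs_def1; lra. }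
assert (Hvm := Hub v Hv). assert (Ev : v = hi).
{ unfold v in *. unfold Rmin in *. destruct Rle_dec; lra. }
destruct Hv as [_ Hv]. now rewrite Ev in Hv.
Qed.

(** * The weak topology tested by filters *)

Section TestsRealization.

Variables (A : Type) (K : list A -> Prop).
Hypothesis K_incl : forall s s', incl s' s -> K s -> K s'.

(** Eventually [y z] lies in one of finitely many closed simplices. For those containing [y0],
    openness of the trace of [V] applies; the others are eventually avoided, because a positive
    coordinate of [y0] outside them stays positive. *)
Lemma realization_open_conv V : is_open (realization K) V ->
  forall Z (F : (Z -> Prop) -> Prop), Filter F -> forall y y0, V y0 ->
  conv (conv_realization K) F y y0 -> F (fun z => V (y z)).
Proof.
intros HV Z F FF y y0 Hy0 (H1 & S & H2 & H3). simpl in *.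
destruct (NoDup_lists_finite S) as [LL HLL].
assert (HF : F (fun z => forall L, In L LL -> NoDup L -> K L -> supported (proj1_sig (y z)) L -> V (y z))).
{ apply filter_forall_in; trivial. intros L _.
  destruct (classic (NoDup L /\ K L)) as [[HN HK]|Hn]; [|apply filter_true'; tauto].
  destruct (classic (supported (proj1_sig y0) L)) as [HS|HS].
  - destruct (HV L HN HK y0 Hy0 HS) as (eps & He & Hball).
    assert (Hc : F (fun z => forall x, In x L -> Rabs (proj1_sig (y z) x - proj1_sig y0 x) < eps)).
    { apply filter_forall_in; trivial. intros x _. specialize (H1 x). rewrite rlim_eps in H1; auto. }
    revert Hc. apply filter_imp. intros z Hz _ _ HzS. now apply Hball.
  - apply not_all_ex_not in HS. destruct HS as [x Hx]. apply imply_to_and in Hx. destruct Hx as [Hx HxL].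
    assert (Hpos := rpoint_nonneg x (proj2_sig y0)).
    generalize (rlim_lt FF (@rlim_const Z F FF 0) (H1 x) ltac:(lra)). apply filter_imp.
    intros z Hz _ _ HzS. elim HxL. apply HzS. lra. }
generalize (filter_and _ _ HF H3). apply filter_imp. intros z [H4 H5].
destruct (rpoint_support (proj2_sig (y z))) as (L & HN & HL).
apply (H4 L); trivial.
- apply HLL; trivial. intros x Hx. now apply H5, HL.
- apply (rpoint_simplex K_incl L (proj2_sig (y z))). intros x. apply HL.
- intros x Hx. now apply HL.
Qed.

(** The hypothesis is used on the neighborhood filter of [p] in a single closed simplex, with the
    identity map. *)
Lemma conv_realization_open V :
  (forall Z (F : (Z -> Prop) -> Prop), Filter F -> forall y y0, V y0 ->
     conv (conv_realization K) F y y0 -> F (fun z => V (y z))) -> is_open (realization K) V.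
Proof.
intros H s HN HK p Hp Hps.
set (F := within (fun q : pt (realization K) => supported (proj1_sig q) s)
  (balls (fun q => lmax (fun x => Rabs (proj1_sig q x - proj1_sig p x)) s))).
assert (FB := balls_filter (fun q : pt (realization K) => lmax (fun x => Rabs (proj1_sig q x - proj1_sig p x)) s)).
assert (FF : Filter F) by now apply within_filter.
assert (HF : F (fun q => supported (proj1_sig q) s)) by (exists 1; split; [lra|auto]).
destruct (H _ F FF (fun q => q) p Hp) as (eps & He & Hball).
- split; [|exists s; auto]. intros x. apply rlim_eps; trivial. intros eps He.
  exists eps. split; trivial. intros q Hq Hqs. destruct (classic (In x s)) as [Hx|Hx].
  + eapply Rle_lt_trans; [|exact Hq]. now apply (lmax_ge (fun x => Rabs (proj1_sig q x - proj1_sig p x))).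
  + rewrite (supported_zero x Hqs Hx), (supported_zero x Hps Hx), Rminus_diag, Rabs_R0. exact He.
- exists eps. split; trivial. intros q Hqs Hq. apply Hball; trivial.
  destruct (Rlt_le_dec 0 (lmax (fun x => Rabs (proj1_sig q x - proj1_sig p x)) s)) as [E|E]; [|lra].
  destruct (lmax_attained _ _ E) as (x & Hx & <-). auto.
Qed.

(* The product with the interval keeps the weak topology, by the tube lemma over a compact subinterval. *)
Lemma tests_realization : tests (realization K) (conv_realization K).
Proof.
split.
- exact realization_open_conv.
- exact conv_realization_open.
- intros W H p s HW.
  assert (FI := balls_filter (fun s' : pt unit_interval => Rabs (proj1_sig s' - proj1_sig s))).
  destruct (H _ (interval_nbhd (proj1_sig s)) FI (fun _ => p) p (fun s' => s') s HW) as (e & He & Hball).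
  { now apply conv_const. }
  { apply rlim_eps; trivial. intros eps He. exists eps. auto. }
  (* The open box around [(p, s)]: the points whose whole slice over the closed interval of radius
     [e / 2] lies in [W], times the open interval of that radius. Halving [e] keeps the closed
     interval inside the ball where [W] is known at [p]. *)
  exists (fun q => forall s', Rabs (proj1_sig s' - proj1_sig s) <= e / 2 -> W (q, s')),
    (fun s' => Rabs (proj1_sig s' - proj1_sig s) < e / 2).
  split; [|split; [|split; [|split]]].
  + apply conv_realization_open. intros Z F FF y y0 Hy0 Hy.
    set (lo := Rmax 0 (proj1_sig s - e / 2)). set (hi := Rmin 1 (proj1_sig s + e / 2)).
    assert (Hlohi : forall t, lo <= t <= hi -> 0 <= t <= 1 /\ Rabs (t - proj1_sig s) <= e / 2).
    { intros t Ht. unfold lo, hi in Ht. revert Ht. unfold Rmax, Rmin.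
      repeat destruct Rle_dec; intros; (split; [lra|apply Rabs_le; lra]). }
    assert (HF : F (fun z => forall t, lo <= t <= hi -> forall Ht : 0 <= t <= 1, W (y z, exist _ t Ht))).
    { apply compact_filter; trivial. intros t Ht. destruct (Hlohi t Ht) as [Ht1 Ht2].
      set (t' := exist (fun t => 0 <= t <= 1) t Ht1 : pt unit_interval).
      assert (FI' := balls_filter (fun s' : pt unit_interval => Rabs (proj1_sig s' - proj1_sig t'))).
      destruct (H _ (filter_prod F (interval_nbhd (proj1_sig t'))) (filter_prod_filter _ _ _ _ FF FI')
        (fun q => y (fst q)) y0 snd t') as [Q R0 HQ (del & Hdel & HR) HQR].
      - now apply Hy0.
      - destruct Hy as (H1 & S & H2 & H3). split.
        + intros x. apply (filterlim_comp _ _ _ fst (fun z => proj1_sig (y z) x) _ F); [|exact (H1 x)].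
          apply filterlim_fst.
        + exists S. split; trivial. apply Filter_prod with (1 := H3) (R := fun _ => True); trivial.
          apply Hierarchy.filter_true.
      - now apply rlim_prod_interval.
      - exists del. split; trivial. revert HQ. apply filter_imp. intros z Hz u _ Hu Hu1.
        apply (HQR z (exist _ u Hu1)); trivial. now apply HR. }
    revert HF. apply filter_imp. intros z Hz [t Ht] Hts. apply Hz.
    change (Rabs (t - proj1_sig s) <= e / 2) in Hts.
    assert (Hts' : - (e / 2) <= t - proj1_sig s <= e / 2).
    { pose proof (Rle_abs (t - proj1_sig s)) as H1. pose proof (Rle_abs (- (t - proj1_sig s))) as H2.
      rewrite Rabs_Ropp in H2. lra. }
    assert (Ht' : 0 <= t <= 1) by exact Ht.
    unfold lo, hi. split; [apply Rmax_lub|apply Rmin_glb]; lra.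
  + intros s' Hs'. apply Hball. lra.
  + apply interval_ball_open.
  + rewrite Rminus_diag, Rabs_R0. lra.
  + intros q s' Hq Hs'. apply Hq. lra.
Qed.

End TestsRealization.

(** * Assembling the Dowker and nerve equivalences *)

Lemma rips_of_cover X (d : X -> X -> R) I (U : I -> X -> Prop) :
  is_metric d -> good_cover d U -> numerable_cover d U ->
  homotopy_equivalent (realization (in_some_member U)) (metric_space d).
Proof.
intros Hd Hgood Hnum.
destruct (nerve_theorem Hd Hgood Hnum) as (f & g & Hf & Hg & Hgf & Hfg).
set (R := fun x i => U i x).
change (homotopy_equivalent (realization (common R)) (metric_space d)).
destruct (dowker_map R) as (D & HD & HDR).
destruct (dowker_map U) as (D' & HD' & HDR').
assert (HDD : conv_homotopic (conv_realization (common R)) (conv_realization (common R))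
  (fun t => D' (D t)) (fun t => t)).
{ apply (@dowker_inverse X I R D D' HD HD' HDR). intros t a b. apply HDR'. }
assert (HDD' : conv_homotopic (conv_realization (common U)) (conv_realization (common U))
  (fun t => D (D' t)) (fun t => t)).
{ apply (@dowker_inverse I X U D' D HD' HD HDR'). intros t a b. apply HDR. }
assert (TK : tests (realization (common R)) (conv_realization (common R))).
{ apply tests_realization. intros s s'. apply common_incl. }
assert (TX := tests_metric Hd).
exists (fun t => g (D t)), (fun x => D' (f x)). split; [|split; [|split]].
- apply (continuous_of_conv TK TX). intros Z F FF t t0 Ht. apply Hg; trivial. now apply HD.
- apply (continuous_of_conv TX TK). intros Z F FF x x0 Hx. apply HD'; trivial. now apply Hf.
(* The inner composite [f] after [g] on the nerve is contracted first, leaving [D'] after [D], which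
   Dowker duality handles. On the side of [X] the inner composite is [D] after [D']. *)
- apply (homotopic_of_conv TK TK). apply conv_homotopic_trans with (fun t => D' (D t)); trivial.
  exact (conv_homotopic_comp HD HD' Hfg).
- apply (homotopic_of_conv TX TX). apply conv_homotopic_trans with (fun x => g (f x)); trivial.
  exact (conv_homotopic_comp Hf Hg HDD').
Qed.

Theorem mainTheorem3 :
  forall (X : Type) (d : X -> X -> R), is_metric d ->
  forall r : R, 0 < r ->
  (forall (I : Type) (U : I -> X -> Prop),
     is_cover U -> good_cover d U -> numerable_cover d U ->
     (forall s : list X, in_some_member U s <-> diam d s < r) ->
     homotopy_equivalent (Rips d r) (metric_space d)) /\
  (forall (I : Type) (U : I -> X -> Prop),
     is_cover U -> good_cover d U -> numerable_cover d U ->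
     (forall s : list X, in_some_member U s <-> diam d s <= r) ->
     homotopy_equivalent (Rips_closed d r) (metric_space d)).
Proof.
intros X d Hd r _. split; intros I U _ Hgood Hnum HU.
- replace (Rips d r) with (realization (in_some_member U)); [now apply rips_of_cover|].
  unfold Rips. f_equal. apply functional_extensionality. intros s.
  now apply propositional_extensionality.
- replace (Rips_closed d r) with (realization (in_some_member U)); [now apply rips_of_cover|].
  unfold Rips_closed. f_equal. apply functional_extensionality. intros s.
  now apply propositional_extensionality.
Qed.
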